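(* Let $a>0$, $b>0$, $m\in\mathbb{R}$, $\theta>0$, and let $(Y_\infty,X_\infty)$ be a random vector with values in $\mathbb{R}_+\times\mathbb{R}$ whose distribution is given by $$\mathbb{E}\big(e^{-\lambda_1Y_\infty+i\lambda_2X_\infty}\big)=\exp\left\{-a\int_0^\infty v_s(\lambda_1,\lambda_2)\,ds+i\frac{m}{\theta}\lambda_2\right\},\qquad(\lambda_1,\lambda_2)\in\mathbb{R}_+\times\mathbb{R},$$ where $v_t(\lambda_1,\lambda_2)$, $t\ge0$, is the unique non-negative solution of $$\begin{cases}\frac{\partial v_t}{\partial t}(\lambda_1,\lambda_2)=-b\,v_t(\lambda_1,\lambda_2)-\frac12\big(v_t(\lambda_1,\lambda_2)\big)^2+\frac12e^{-2\theta t}\lambda_2^2,& t\ge0,\\ v_0(\lambda_1,\lambda_2)=\lambda_1.\end{cases}$$ Then $(Y_\infty,X_\infty)$ is absolutely continuous (with respect to Lebesgue measure on $\mathbb{R}^2$), and the Laplace transform of $Y_\infty$ takes the form $$\mathbb{E}(e^{-\lambda_1Y_\infty})=\left(1+\frac{\lambda_1}{2b}\right)^{-2a},\qquad\lambda_1\in\mathbb{R}_+,$$ so that $Y_\infty$ has Gamma distribution with parameters $2a$ (shape) and $2b$ (rate). Further, all the (mixed) moments of $(Y_\infty,X_\infty)$ of any order are finite, i.e. $\mathbb{E}(Y_\infty^n|X_\infty|^p)<\infty$ for all $n,p\in\mathbb{Z}_+$, and especially $$\mathbb{E}(Y_\infty)=\frac ab,\qquad\mathbb{E}(X_\infty)=\frac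 m\theta,$$ $$\mathbb{E}(Y_\infty^2)=\frac{a(2a+1)}{2b^2},\qquad\mathbb{E}(Y_\infty X_\infty)=\frac{ma}{\theta b},\qquad\mathbb{E}(X_\infty^2)=\frac{a\theta+2bm^2}{2b\theta^2},$$ $$\mathbb{E}(Y_\infty X_\infty^2)=\frac{a}{(b+2\theta)2b^2\theta^2}\big(\theta(ab+2a\theta+\theta)+2m^2b(2\theta+b)\big).$$
   Context: $\mathbb{R}_+=[0,\infty)$ and $\mathbb{Z}_+=\{0,1,2,\dots\}$. A distribution on $\mathbb{R}_+\times\mathbb{R}$ with the stated transform exists and is unique: it is the limit in distribution as $t\to\infty$, and the stationary distribution, of the solution $(Y_t,X_t)_{t\ge0}$ (with $Y\ge0$) of the SDE $dY_t=(a-bY_t)\,dt+\sqrt{Y_t}\,dL_t$, $dX_t=(m-\theta X_t)\,dt+\sqrt{Y_t}\,dB_t$, where $L$ and $B$ are independent standard Wiener processes and the initial value $(Y_0,X_0)$, with $Y_0\ge0$ almost surely, is independent of $(L,B)$. *)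

(* Defs.v *)
From HB Require Import structures.
From mathcomp Require Import all_boot all_order all_algebra.
From mathcomp Require Import complex.
From mathcomp Require Import all_classical all_reals all_analysis.

Set Implicit Arguments.
Unset Strict Implicit.
Unset Printing Implicit Defensive.

Import Order.TTheory GRing.Theory Num.Theory.
Import numFieldNormedType.Exports.

Local Open Scope classical_set_scope.
Local Open Scope ring_scope.
Local Open Scope complex_scope.

Definition cexp (R : realType) (z : R[i]) : R[i] :=
  (expR (complex.Re z) * cos (complex.Im z))
  +i* (expR (complex.Re z) * sin (complex.Im z)).

(* Meaningful only when the real and imaginary parts are integrable, since
   [fine] sends infinite values to 0. *)
Definition cexpectation d (T : measurableType d) (R : realType)
    (P : probability T R) (Z : T -> R[i]) : R[i] :=
  fine ('E_P[fun w => complex.Re (Z w)])%E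
  +i* fine ('E_P[fun w => complex.Im (Z w)])%E.

Definition riccati_rhs (R : realType) (b theta l2 : R) (f : R -> R) (t : R) : R :=
  - b * f t - 2^-1 * f t ^+ 2 + 2^-1 * expR (- 2 * theta * t) * l2 ^+ 2.

(* Only the values of [f] on [0, +oo) matter; the derivative at 0 is the
   right derivative. *)
Definition nonneg_riccati_solution (R : realType) (b theta l1 l2 : R)
    (f : R -> R) : Prop :=
  [/\ f 0 = l1,
      forall t : R, 0 <= t -> 0 <= f t,
      h^-1 * (f h - f 0) @[h --> 0^'+] --> riccati_rhs b theta l2 f 0
    & forall t : R, 0 < t -> is_derive t 1 f (riccati_rhs b theta l2 f t)].

Definition gamma_fun (R : realType) (alpha : R) : R :=
  \int[lebesgue_measure]_(x in `]0, +oo[) (x `^ (alpha - 1) * expR (- x)).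

(* [rate] is the inverse of the scale parameter. *)
Definition gamma_pdf (R : realType) (shape rate : R) : R -> R :=
  (fun x => rate `^ shape / gamma_fun shape
            * x `^ (shape - 1) * expR (- rate * x)) \_ `]0, +oo[.

Definition gamma_prob (R : realType) (shape rate : R) (A : set R) : \bar R :=
  (\int[lebesgue_measure]_(x in A) (gamma_pdf shape rate x)%:E)%E.

(* Main.v *)
(* Write [v = 2 u' / u] to linearise the Riccati equation: [u t] is [expR (- b * t)] times
   an entire series in [l2 ^+ 2 * expR (- 2 * theta * t)], and integrating [v] turns the
   transform of [(Y, X - m / theta)] at [(l, s)] into
     ((eser (s ^+ 2) + l * dser (s ^+ 2) / 2) / b) `^ (- (2 * a))
   where [dser] and [eser] are entire with positive coefficients, [dser 0 = 1], [eser 0 = b].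
   At [s = 0] this is the Laplace transform of a Gamma law, which determines the law of [Y].
   For fixed [s] it is, as a function of [l], the Laplace transform of the law of [Y]
   reweighted by a density in [y], which is therefore the characteristic function at [s] of
   [X - m / theta] given [Y = y].  That density is at most [dser (s ^+ 2) `^ (- (2 * a))],
   uniformly in [y], and this decays faster than any power of [s].  Smoothing with a Poisson
   kernel bounds P(Y in B, X in [u, v[) by a constant times (v - u) P(Y in B), so the law of
   [(Y, X)] is dominated by the product of the law of [Y] and Lebesgue measure.
   Moments are finite because the transform is smooth, and are computed by
   differentiating it at the origin. *)

Require Import Defs.
From mathcomp Require Import all_boot all_order all_algebra.
From mathcomp Require Import complex.
From mathcomp Require Import all_classical all_reals all_analysis measurable_realfun.
From mathcomp Require Import ring lra.

Import Order.TTheory GRing.Theory Num.Theory.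
Import numFieldNormedType.Exports.

Local Open Scope classical_set_scope.
Local Open Scope ring_scope.

Set Implicit Arguments.
Unset Strict Implicit.
Unset Printing Implicit Defensive.

(** * Laplace transforms determine laws on the half-line *)

Section real_integrals.
Context {d} {T : measurableType d} {R : realType} {mu : {measure set T -> \bar R}}.
Implicit Types f g h : T -> R.
Local Notation intg f := (mu.-integrable setT (EFin \o f)).

Lemma le_intg f g : measurable_fun setT f -> (forall x, `|f x| <= g x) ->
  intg g -> intg f.
Proof.
move=> mf fg ig; apply: le_integrable ig => //; first exact/measurable_EFinP.
by move=> x _ /=; rewrite lee_fin (le_trans (fg x))// ler_norm.
Qed.

Lemma intg_measurable f : intg f -> measurable_fun setT f.
Proof. by move=> /measurable_int/measurable_EFinP. Qed.

Lemma measurable_lim (f_ : nat -> T -> R) f :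
  (forall n, measurable_fun setT (f_ n)) ->
  (forall x, f_ n x @[n --> \oo] --> f x) -> measurable_fun setT f.
Proof.
move=> mf_ f_f; apply/measurable_EFinP.
apply: (emeasurable_fun_cvg (fun n => EFin \o f_ n)) => [n|x _].
  exact/measurable_EFinP.
by apply: cvg_EFin; [exact: nearW|exact: f_f].
Qed.

Lemma Rdominated_cvg (f_ : nat -> T -> R) f g :
  (forall n, measurable_fun setT (f_ n)) ->
  (forall x, f_ n x @[n --> \oo] --> f x) ->
  (forall n x, `|f_ n x| <= g x) -> intg g ->
  intg f /\ \int[mu]_x f_ n x @[n --> \oo] --> \int[mu]_x f x.
Proof.
move=> mf_ f_f f_g ig.
have mf : measurable_fun setT f by exact: measurable_lim mf_ f_f.
have fg x : `|f x| <= g x.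
  have /cvg_norm h := f_f x.
  by rewrite -(cvg_lim _ h)//; apply: limr_le; [apply/cvg_ex; eexists; exact: h|exact: nearW].
have ifi : intg f by exact: le_intg ig.
split=> //.
have [] := @dominated_convergence _ T R mu setT measurableT (fun n => EFin \o f_ n)
  (EFin \o f) (EFin \o g).
- by move=> n; exact/measurable_EFinP.
- exact/measurable_EFinP.
- by apply: aeW => x _; apply: cvg_EFin; [exact: nearW|exact: f_f].
- exact: ig.
- by apply: aeW => x n _ /=; rewrite lee_fin.
move=> _ _ /= h; rewrite /Rintegral; apply: fine_cvg.
by rewrite fineK//; apply: (integrable_fin_num measurableT ifi).
Qed.

(* Fatou makes the limit integrable, which is what then allows dominated convergence. *)
Lemma increasing_approx_cvg (f_ : nat -> T -> R) f (c : R) :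
  (forall n, measurable_fun setT (f_ n)) ->
  (forall x, f_ n x @[n --> \oo] --> f x) ->
  (forall n x, 0 <= f_ n x <= f x) -> (forall n, intg (f_ n)) ->
  \int[mu]_x f_ n x @[n --> \oo] --> c ->
  intg f /\ \int[mu]_x f x = c.
Proof.
move=> mf_ f_f f_le if_ f_c.
have mf : measurable_fun setT f by exact: measurable_lim mf_ f_f.
have f0 x : 0 <= f x by have /andP[/le_trans] := f_le 0 x; apply.
have ifi : intg f.
  apply/integrableP; split; first exact/measurable_EFinP.
  rewrite (eq_integral (fun x => limn_einf (fun n => (f_ n x)%:E))); last first.
    move=> x _; rewrite /= ger0_norm//.
    have h : (f_ n x)%:E @[n --> \oo] --> (f x)%:E.
      by apply: cvg_EFin; [exact: nearW|exact: f_f].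
    by rewrite is_cvg_limn_einfE; [rewrite (cvg_lim _ h)|exact: cvgP h].
  apply: (@le_lt_trans _ _ (limn_einf (fun n => \int[mu]_x (f_ n x)%:E)%E)).
    apply: fatou => // [n|n x _]; first exact/measurable_EFinP.
    by rewrite lee_fin; have /andP[] := f_le n x.
  have -> : (fun n => \int[mu]_x (f_ n x)%:E)%E = EFin \o (fun n => \int[mu]_x f_ n x).
    by apply/funext => n /=; rewrite /Rintegral fineK//; apply: (integrable_fin_num measurableT (if_ n)).
  have h : (EFin \o (fun n => \int[mu]_x f_ n x)) n @[n --> \oo] --> c%:E.
    by apply: cvg_EFin; [exact: nearW|exact: f_c].
  by rewrite is_cvg_limn_einfE ?(cvg_lim _ h)// ?ltry//; exact: cvgP h.
split=> //; have fn n x : `|f_ n x| <= f x.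
  by have /andP[f1 f2] := f_le n x; rewrite ger0_norm.
have [_ h] := Rdominated_cvg mf_ f_f fn ifi.
exact: cvg_unique h f_c.
Qed.

Lemma intg_restrict f D : measurable D ->
  mu.-integrable D (EFin \o f) <-> intg (f \_ D).
Proof.
move=> mD; rewrite (_ : EFin \o f \_ D = (EFin \o f) \_ D).
  exact: integrable_mkcond.
by apply/funext => x; rewrite /= restrict_EFin.
Qed.

End real_integrals.

Section sharp_threshold.
Context {R : realType}.

Lemma natmul_exp_cvg0 (x : R) : 0 <= x < 1 -> n%:R * x ^+ n @[n --> \oo] --> 0.
Proof.
move=> /andP[x0 x1]; set s := 1 - x.
have s0 : 0 < s by rewrite subr_gt0.
(* From [x <= expR (- s)] and [z ^+ 2 / 2 <= expR z] at [z = s * n.+1%:R]. *)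
have bnd n : 0 <= n.+1%:R * x ^+ n.+1 <= 2 / s ^+ 2 * n.+1%:R^-1.
  rewrite mulr_ge0 ?exprn_ge0//=.
  have xs : x <= expR (- s) by rewrite -[leLHS](subKr 1) (le_trans _ (expR_ge1Dx _))// /s.
  have sn : 0 < s * n.+1%:R by rewrite mulr_gt0.
  have h : (s * n.+1%:R) ^+ 2 / 2 <= expR (s * n.+1%:R).
    by have := @expR_ge1Dxn R _ 1 (ltW sn); rewrite (_ : (2`!)%:R = 2 :> R)//; lra.
  apply: (@le_trans _ _ (n.+1%:R * expR (- (s * n.+1%:R)))).
    rewrite ler_wpM2l// -mulNr expRM_natr lerXn2r// ?nnegrE// expR_ge0//.
  have -> : 2 / s ^+ 2 * n.+1%:R^-1 = n.+1%:R * ((s * n.+1%:R) ^+ 2 / 2)^-1.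
    by field; rewrite ?gt_eqF//= andbT addrC natr1.
  rewrite expRN ler_wpM2l// lef_pV2// posrE ?expR_gt0//.
  by rewrite divr_gt0// exprn_gt0.
rewrite -(cvg_shiftS (fun n => n%:R * x ^+ n)).
apply: (@squeeze_cvgr _ _ _ _ (cst 0) (fun n => 2 / s ^+ 2 * n.+1%:R^-1)).
- exact: nearW.
- exact: cvg_cst.
- rewrite -[X in _ --> X](mulr0 (2 / s ^+ 2)); apply: cvgMr; exact: cvg_harmonic.
Qed.

Lemma bernoulli_le (x : R) n : 0 <= x <= 1 -> 1 - n%:R * x <= (1 - x) ^+ n.
Proof.
move=> /andP[x0 x1]; elim: n => [|n IH]; first by rewrite mul0r subr0 expr0.
rewrite exprS (@le_trans _ _ ((1 - x) * (1 - n%:R * x)))//.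
  rewrite -natr1; have : 0 <= n%:R * x ^+ 2 by rewrite mulr_ge0// sqr_ge0.
  by nra.
by rewrite ler_wpM2l// subr_ge0.
Qed.

(* The exponent [n * 2 ^ n] rather than [2 ^ n] makes the limit at [1/2] equal to [0]. *)
Lemma sharp_threshold_cvg (u : R) : 0 <= u <= 1 ->
  (1 - u ^+ n) ^+ (n * 2 ^ n) @[n --> \oo] --> ((u < 2^-1)%R%:R : R).
Proof.
move=> /andP[u0 u1]; have un n : 0 <= u ^+ n <= 1 by rewrite exprn_ge0// exprn_ile1.
have [u2|u2] := ltP u 2^-1.
  apply: (@squeeze_cvgr _ _ _ _ (fun n => 1 - n%:R * (2 * u) ^+ n) (cst 1)).
  - apply: nearW => n; apply/andP; split.
      have := bernoulli_le (n * 2 ^ n) (un n).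
      by rewrite natrM natrX exprMn mulrA.
    by have /andP[a b] := un n; rewrite exprn_ile1 ?subr_ge0// gerBl.
  - rewrite -[X in _ --> X](subr0 1); apply: cvgB; first exact: cvg_cst.
    by apply: natmul_exp_cvg0; apply/andP; split; lra.
  - exact: cvg_cst.
apply: (@squeeze_cvgr _ _ _ _ (cst 0) (fun n => expR (- n%:R))).
- apply: nearW => n; have /andP[a b] := un n.
  rewrite exprn_ge0 ?subr_ge0//=.
  have -> : - n%:R = (- 2^-1 ^+ n) * (n * 2 ^ n)%:R :> R.
    by rewrite natrM natrX mulNr mulrCA -exprMn mulVf// expr1n mulr1.
  rewrite expRM_natr lerXn2r ?nnegrE ?subr_ge0 ?expR_ge0//.
  apply: le_trans (expR_ge1Dx _); rewrite lerD2l lerN2.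
  by rewrite lerXn2r ?nnegrE ?invr_ge0.
- exact: cvg_cst.
- exact: cvgn_expR.
Qed.

End sharp_threshold.

Section laplace_uniqueness.
Context {R : realType} {d1 d2} {T1 : measurableType d1} {T2 : measurableType d2}.
Context {mu1 : {measure set T1 -> \bar R}} {mu2 : {measure set T2 -> \bar R}}.
Variables (h1 Y1 : T1 -> R) (h2 Y2 : T2 -> R).
Hypothesis (mY1 : measurable_fun setT Y1) (mY2 : measurable_fun setT Y2).
Hypothesis (Y1_ge0 : forall x, 0 <= Y1 x) (Y2_ge0 : forall x, 0 <= Y2 x).
Hypothesis (ih1 : mu1.-integrable setT (EFin \o h1)).
Hypothesis (ih2 : mu2.-integrable setT (EFin \o h2)).
Hypothesis laplace_eq : forall l, 0 <= l ->
  \int[mu1]_x (h1 x * expR (- (l * Y1 x))) = \int[mu2]_x (h2 x * expR (- (l * Y2 x))).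

(** A polynomial in [w = expR (- (l * (Y x + 1)))], so its integral is determined by Laplace
    transforms. The shift [Y + 1] makes [w = 1/2] reachable at [Y = t] for every [t >= 0], including
    [t = 0]. *)
Let bump d (T : measurableType d) (Y : T -> R) l n k j (x : T) :=
  (1 - expR (- (l * (Y x + 1))) ^+ n) ^+ k * expR (- (l * (Y x + 1))) ^+ j.

Let bump01 d (T : measurableType d) (Y : T -> R) l n k j x :
  0 <= l -> 0 <= Y x -> 0 <= bump Y l n k j x <= 1.
Proof.
move=> l0 Y0; have e1 : expR (- (l * (Y x + 1))) <= 1.
  by rewrite expR_le1 oppr_le0 mulr_ge0// addr_ge0.
have e0 := expR_ge0 (- (l * (Y x + 1))).
have en : expR (- (l * (Y x + 1))) ^+ n <= 1 by rewrite exprn_ile1.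
rewrite mulr_ge0 ?exprn_ge0 ?subr_ge0//=.
by rewrite mulr_ile1 ?exprn_ge0 ?exprn_ile1 ?subr_ge0 ?gerBl// exprn_ge0.
Qed.

Let measurable_bump d (T : measurableType d) (Y : T -> R) l n k j :
  measurable_fun setT Y -> measurable_fun setT (bump Y l n k j).
Proof.
move=> mY; have me : measurable_fun setT (fun x => expR (- (l * (Y x + 1)))).
  apply: measurableT_comp => //; apply: measurableT_comp => //.
  by apply: measurable_funM => //; exact: measurable_funD.
apply: measurable_funM; apply: measurable_funX => //.
by apply: measurable_funB => //; exact: measurable_funX.
Qed.

Let integrable_bump d (T : measurableType d) (mu : {measure set T -> \bar R})
    (Y h : T -> R) l n k j :
  measurable_fun setT Y -> (forall x, 0 <= Y x) -> 0 <= l ->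
  mu.-integrable setT (EFin \o h) ->
  mu.-integrable setT (EFin \o (fun x => h x * bump Y l n k j x)).
Proof.
move=> mY Y0 l0 ih; apply: (@le_intg _ _ _ _ _ (fun x => `|h x|)).
- apply: measurable_funM; last exact: measurable_bump.
  exact: intg_measurable ih.
- move=> x; have /andP[b0 b1] := bump01 n k j l0 (Y0 x).
  by rewrite normrM (ger0_norm b0) ler_piMr.
- exact: integrable_norm.
Qed.

(** Peeling off one factor [1 - w ^+ n] at a time leaves two bumps with smaller [k], one of them
    with [j] raised by [n]; hence the free exponent [j]. For [k = 0] only a Laplace transform
    remains. *)
Let bump_eq l n k j : 0 <= l ->
  \int[mu1]_x (h1 x * bump Y1 l n k j x) = \int[mu2]_x (h2 x * bump Y2 l n k j x).
Proof.
move=> l0; elim: k j => [|k IH] j.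
  have E d (T : measurableType d) (mu : {measure set T -> \bar R}) (h Y : T -> R) :
      measurable_fun setT Y -> (forall x, 0 <= Y x) -> mu.-integrable setT (EFin \o h) ->
      \int[mu]_x (h x * bump Y l n 0 j x) =
      expR (- (l * j%:R)) * \int[mu]_x (h x * expR (- (l * j%:R * Y x))).
    move=> mY Y0 ih; rewrite -RintegralZl//; last first.
      apply: (@le_intg _ _ _ _ _ (fun x => `|h x|)).
      - apply: measurable_funM; first exact: intg_measurable ih.
        apply: measurableT_comp => //; apply: measurableT_comp => //.
        exact: measurable_funM.
      - move=> x; rewrite normrM (ger0_norm (expR_ge0 _)) ler_piMr//.
        by rewrite expR_le1 oppr_le0 !mulr_ge0.
      - exact: integrable_norm.
    apply: eq_Rintegral => x _; rewrite /bump expr0 mul1r -expRM_natr mulrCA -expRD.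
    by congr (_ * expR _); ring.
  by rewrite !E// laplace_eq// mulr_ge0.
have E d (T : measurableType d) (mu : {measure set T -> \bar R}) (h Y : T -> R) :
    measurable_fun setT Y -> (forall x, 0 <= Y x) -> mu.-integrable setT (EFin \o h) ->
    \int[mu]_x (h x * bump Y l n k.+1 j x) =
    \int[mu]_x (h x * bump Y l n k j x) - \int[mu]_x (h x * bump Y l n k (j + n) x).
  move=> mY Y0 ih; rewrite -RintegralB//; [|exact: integrable_bump..].
  by apply: eq_Rintegral => x _; rewrite /bump exprS exprD; ring.
by rewrite !E// !IH.
Qed.

(** The value [l = ln 2 / (t + 1)] makes [w < 1/2] equivalent to [t < Y], so the sharp threshold
    turns the bumps into the indicator of a half-line. *)
Let bump_cvg d (T : measurableType d) (mu : {measure set T -> \bar R})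
    (Y h : T -> R) t : 0 <= t ->
  measurable_fun setT Y -> (forall x, 0 <= Y x) -> mu.-integrable setT (EFin \o h) ->
  \int[mu]_x (h x * bump Y (ln 2 / (t + 1)) n (n * 2 ^ n) 0 x) @[n --> \oo] -->
  \int[mu]_(x in Y @^-1` `]t, +oo[) h x.
Proof.
move=> t0 mY Y0 ih; set l := ln 2 / (t + 1).
have t1 : 0 < t + 1 by rewrite ltr_wpDl.
have l20 : 0 < ln 2 :> R by rewrite ln_gt0// ltr1n.
have l0 : 0 <= l by rewrite divr_ge0 ?ltW.
rewrite Rintegral_mkcond.
have [] // := @Rdominated_cvg _ T R mu (fun n x => h x * bump Y l n (n * 2 ^ n) 0 x)
  (h \_ (Y @^-1` `]t, +oo[)) (fun x => `|h x|).
- by move=> n; apply: intg_measurable (integrable_bump n (n * 2 ^ n) 0 mY Y0 l0 ih).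
- move=> x; rewrite patchE.
  have -> : (if x \in Y @^-1` `]t, +oo[ then h x else 0) =
     h x * (expR (- (l * (Y x + 1))) < 2^-1)%R%:R.
    have <- : expR (- ln 2) = 2^-1 :> R by rewrite expRN lnK// posrE.
    rewrite ltr_expR ltrN2.
    have -> : (ln 2 < l * (Y x + 1)) = (t < Y x).
      by rewrite /l mulrAC ltr_pdivlMr// ltr_pM2l// ltrD2r.
    by case: ifPn; rewrite ?inE ?notin_setE /= in_itv /= andbT; case: ltP => // _;
       rewrite ?mulr1 ?mulr0.
  apply: cvgMr; rewrite /bump; under eq_fun do rewrite expr0 mulr1.
  apply: sharp_threshold_cvg; rewrite expR_ge0 expR_le1 oppr_le0 mulr_ge0//.
  by rewrite addr_ge0.
- move=> n x; have /andP[b0 b1] := bump01 n (n * 2 ^ n) 0 l0 (Y0 x).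
  by rewrite normrM (ger0_norm b0) ler_piMr.
- exact: integrable_norm.
Qed.

(** The weights [h1] and [h2] may change sign: the lemma is applied to cosines and sines of [X] as
    well as to densities. Open half-lines are a generating class stable under intersection, and
    integrability allows the subtraction needed for complements. *)
Lemma laplace_unique B : measurable B ->
  (\int[mu1]_(x in Y1 @^-1` B) (h1 x)%:E = \int[mu2]_(x in Y2 @^-1` B) (h2 x)%:E)%E.
Proof.
have mpre1 A : measurable A -> measurable (Y1 @^-1` A).
  by move=> mA; rewrite -[X in measurable X]setTI; exact: mY1.
have mpre2 A : measurable A -> measurable (Y2 @^-1` A).
  by move=> mA; rewrite -[X in measurable X]setTI; exact: mY2.
have iS1 A : measurable A -> mu1.-integrable (Y1 @^-1` A) (EFin \o h1).
  by move=> mA; apply: integrableS ih1 => //; exact: mpre1.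
have iS2 A : measurable A -> mu2.-integrable (Y2 @^-1` A) (EFin \o h2).
  by move=> mA; apply: integrableS ih2 => //; exact: mpre2.
have eqE A : measurable A ->
    \int[mu1]_(x in Y1 @^-1` A) h1 x = \int[mu2]_(x in Y2 @^-1` A) h2 x ->
    (\int[mu1]_(x in Y1 @^-1` A) (h1 x)%:E = \int[mu2]_(x in Y2 @^-1` A) (h2 x)%:E)%E.
  move=> mA e; move: (congr1 EFin e); rewrite /Rintegral !fineK//.
    by apply: integrable_fin_num; [exact: mpre2|exact: iS2].
  by apply: integrable_fin_num; [exact: mpre1|exact: iS1].
have eqT : \int[mu1]_x h1 x = \int[mu2]_x h2 x.
  have := laplace_eq (lexx 0).
  by under eq_Rintegral do rewrite mul0r oppr0 expR0 mulr1;
     under [RHS]eq_Rintegral do rewrite mul0r oppr0 expR0 mulr1.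
move=> mB; pose Pr (A : set R) := (\int[mu1]_(x in Y1 @^-1` A) (h1 x)%:E =
  \int[mu2]_(x in Y2 @^-1` A) (h2 x)%:E)%E.
suff H (S : set R) : <<s (@RGenOInfty.G R)>> S -> Pr S.
  exact: H (eq_ind _ (fun M => M B) mB _ (RGenOInfty.measurableE R)).
apply: (@dynkin_induction _ (measurableTypeR R) (@RGenOInfty.G R) Pr); rewrite /Pr.
- exact: RGenOInfty.measurableE.
- move=> _ _ [x ->] [y ->]; exists (Num.max x y).
  apply/seteqP; split => z /=; rewrite !in_itv/= !andbT gt_max.
    by move=> [-> ->].
  by move=> /andP.
- by apply: eqE => //; rewrite !preimage_setT.
- move=> _ [t ->]; apply: eqE => //; have [t0|t0] := leP 0 t.
    have l0 : 0 <= ln 2 / (t + 1) by rewrite divr_ge0 ?addr_ge0// ln_ge0// ler1n.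
    have c2 := bump_cvg t0 mY2 Y2_ge0 ih2; move: (bump_cvg t0 mY1 Y1_ge0 ih1).
    by under eq_fun do rewrite bump_eq//; move=> /cvg_unique/(_ c2); apply.
  (* For [t < 0] nonnegativity makes the preimage the whole space, which is the Laplace transform at
     0. *)
  have full (T : Type) (Y : T -> R) : (forall x, 0 <= Y x) -> Y @^-1` `]t, +oo[ = setT.
    by move=> Y0; apply/seteqP; split => x //= _; rewrite in_itv/= andbT (lt_le_trans t0).
  by rewrite (full _ _ Y1_ge0) (full _ _ Y2_ge0).
- move=> A mA hA; rewrite -!preimage_setC.
  have E d (T : measurableType d) (mu : {measure set T -> \bar R}) (h : T -> R) D :
      mu.-integrable setT (EFin \o h) -> measurable D ->
      (\int[mu]_(x in ~` D) (h x)%:E =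
       \int[mu]_x (h x)%:E - \int[mu]_(x in D) (h x)%:E)%E.
    move=> ih mD; have iD : mu.-integrable D (EFin \o h) by apply: integrableS ih.
    rewrite -(setUv D) integral_setU//=; last 3 first.
    + exact: measurableC.
    + by rewrite setUv; exact: measurable_int ih.
    + by apply/disj_setPS => x [].
    by rewrite addeAC subee ?add0e//; exact: integrable_fin_num.
  rewrite !E//; [|exact: mpre2|exact: mpre1].
  rewrite hA; congr (_ - _)%E.
  by have := eqE setT measurableT; rewrite !preimage_setT; exact.
- move=> F mF tF hF; rewrite !preimage_bigcup !integral_bigcup//.
  + by apply: eq_eseriesr => i _; exact: hF.
  + by apply/trivIsetP => i j _ _ ij; rewrite -preimage_setI (trivIsetP.1 tF)// preimage_set0.
  + by move=> k; apply: mpre2; exact: mF.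
  + by rewrite -preimage_bigcup; apply: iS2; apply: bigcup_measurable => k _; exact: mF.
  + by apply/trivIsetP => i j _ _ ij; rewrite -preimage_setI (trivIsetP.1 tF)// preimage_set0.
  + by move=> k; apply: mpre1; exact: mF.
  + by rewrite -preimage_bigcup; apply: iS1; apply: bigcup_measurable => k _; exact: mF.
Qed.

End laplace_uniqueness.

(** * Entire series and the Riccati equation *)

Section entire_series.
Context {R : realType}.
Implicit Types (f g : nat -> R) (C c q x : R) (n k : nat).

(** Coefficientwise domination by [C * expR (c * x)]. This is stronger than convergence everywhere,
    but it is visibly stable under differentiation and linear combinations. *)
Definition entire f := exists C c : R,
  [/\ 0 <= C, 0 <= c & forall k, `|f k| <= C * (c ^+ k / k`!%:R)].

Definition psum f x := limn (pseries f x).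

Lemma entire_cvg f x : entire f -> cvgn (pseries f x).
Proof.
move=> [C [c [C0 c0 fC]]]; rewrite /pseries.
apply: normed_cvg; apply: (@series_le_cvg _ _ (fun k => C * exp_coeff (c * `|x|) k)).
- by move=> k /=.
- by move=> k; rewrite mulr_ge0// exp_coeff_ge0// mulr_ge0.
- move=> k /=; rewrite normrM normrX /exp_coeff/= exprMn.
  rewrite [X in _ <= C * X]mulrAC mulrA ler_wpM2r ?exprn_ge0//.
- rewrite (_ : (fun k => _) = C *: exp_coeff (c * `|x|)) //.
  by apply: is_cvg_seriesZ; exact: is_cvg_series_exp_coeff.
Qed.

Lemma entire_diffs f : entire f -> entire (pseries_diffs f).
Proof.
move=> [C [c [C0 c0 fC]]]; exists (C * c), c; split => //; first exact: mulr_ge0.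
move=> k; rewrite /pseries_diffs normrM ger0_norm//.
rewrite (@le_trans _ _ (k.+1%:R * (C * (c ^+ k.+1 / k.+1`!%:R))))// ?ler_wpM2l//.
rewrite le_eqVlt; apply/orP; left; apply/eqP.
rewrite factS natrM exprS; field.
by rewrite pnatr_eq0 -lt0n fact_gt0 /= addrC natr1 pnatr_eq0.
Qed.

Lemma entire_natmul f : entire f -> entire (fun k => k%:R * f k).
Proof.
move=> [C [c [C0 c0 fC]]]; exists C, (2 * c); split => //; first exact: mulr_ge0.
move=> k; rewrite normrM ger0_norm// exprMn.
rewrite -[X in _ <= _ * X]mulrA mulrCA ler_pM//.
by rewrite -natrX ler_nat ltnW// ltn_expl.
Qed.

Lemma entireD f g : entire f -> entire g -> entire (fun k => f k + g k).
Proof.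
move=> [C1 [c1 [C10 c10 fC]]] [C2 [c2 [C20 c20 gC]]].
exists (C1 + C2), (c1 + c2); split; [exact: addr_ge0|exact: addr_ge0|move=> k].
rewrite (le_trans (ler_normD _ _))// mulrDl lerD//.
- rewrite (le_trans (fC k))// ler_wpM2l// ler_wpM2r ?invr_ge0// lerXn2r ?nnegrE ?addr_ge0//.
  by rewrite lerDl.
- rewrite (le_trans (gC k))// ler_wpM2l// ler_wpM2r ?invr_ge0// lerXn2r ?nnegrE ?addr_ge0//.
  by rewrite lerDr.
Qed.

Lemma entireZ C f : entire f -> entire (fun k => C * f k).
Proof.
move=> [C1 [c1 [C10 c10 fC]]]; exists (`|C| * C1), c1; split => //; first exact: mulr_ge0.
by move=> k; rewrite normrM -mulrA ler_wpM2l.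
Qed.

Lemma is_derive_psum f x : entire f -> is_derive x 1 (psum f) (psum (pseries_diffs f) x).
Proof.
move=> ef; apply: (@pseries_snd_diffs _ _ (`|x| + 1)).
- exact: entire_cvg.
- by apply: entire_cvg; exact: entire_diffs.
- by apply: entire_cvg; do 2 apply: entire_diffs.
- by rewrite [ltRHS]ger0_norm ?addr_ge0// ltrDl.
Qed.

Lemma psumD f g x : entire f -> entire g -> psum (fun k => f k + g k) x = psum f x + psum g x.
Proof.
move=> ef eg; apply/cvg_lim => //.
rewrite (_ : pseries _ x = (fun n => pseries f x n + pseries g x n)); last first.
  apply/funext => n; rewrite /pseries /series/= -big_split/=.
  by apply: eq_bigr => k _; rewrite mulrDl.
by apply: cvgD; exact: entire_cvg.
Qed.

Lemma psumZ C f x : entire f -> psum (fun k => C * f k) x = C * psum f x.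
Proof.
move=> ef; apply/cvg_lim => //.
rewrite (_ : pseries _ x = (fun n => C * pseries f x n)); last first.
  apply/funext => n; rewrite /pseries /series/= mulr_sumr.
  by apply: eq_bigr => k _; rewrite mulrA.
by apply: cvgMr; exact: entire_cvg.
Qed.

Lemma psum0 f : psum f 0 = f 0%N.
Proof.
apply: (@lim_near_cst _ _ _ _ _) => //; exists 1%N => // n /= n1.
rewrite /pseries /series/= big_ltn// expr0 mulr1 big1_seq ?addr0//.
by move=> i /=; rewrite mem_index_iota => /andP[i0 _]; rewrite expr0n gtn_eqF// mulr0.
Qed.

(** Multiplying the coefficients by [k] is the Euler operator [x d/dx]. *)
Lemma psum_natmul f x : entire f ->
  psum (fun k => k%:R * f k) x = x * psum (pseries_diffs f) x.
Proof.
move=> ef; apply/cvg_lim => //; rewrite -(cvg_shiftS (pseries _ x)).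
rewrite (_ : (fun n => _) = (fun n => x * pseries (pseries_diffs f) x n)); last first.
  apply/funext => n; rewrite /pseries /series/= big_nat_recl//= !mul0r add0r mulr_sumr.
  by apply: eq_bigr => k _; rewrite /pseries_diffs exprS; ring.
by apply: cvgMr; apply: entire_cvg; exact: entire_diffs.
Qed.

(** With nonnegative terms every partial sum is a lower bound; keeping one monomial of arbitrary
    degree is what later yields decay of any polynomial order. *)
Lemma psum_ge f x n : entire f -> (forall k, 0 <= f k) -> 0 <= x ->
  f 0%N <= psum f x /\ f 0%N + f n.+1 * x ^+ n.+1 <= psum f x.
Proof.
move=> ef f0 x0.
have nd : nondecreasing_seq (pseries f x).
  by apply: nondecreasing_series => k _ _; rewrite mulr_ge0// exprn_ge0.
have h N : pseries f x N <= psum f x.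
  by apply: nondecreasing_cvgn_le nd _ _; exact: entire_cvg.
split.
  by apply: le_trans (h 1%N); rewrite /pseries /series/= big_nat1 expr0 mulr1.
apply: le_trans (h n.+2); rewrite /pseries /series/= big_nat_recr//= lerD2r.
rewrite big_nat_recl//= expr0 mulr1 lerDl sumr_ge0// => k _.
by rewrite mulr_ge0// exprn_ge0.
Qed.

End entire_series.

(** * Functions with derivatives of all orders *)

Section smooth_functions.
Context {R : realType}.

(* A class of functions closed under differentiation and containing the
   characteristic functions whose smoothness is needed. *)
Inductive smooth_class : (R -> R) -> Prop :=
| smooth_cst c : smooth_class (fun=> c)
| smooth_id : smooth_class (fun x => x)
| smooth_psum f : entire f -> smooth_class (fun x => psum f (x ^+ 2))
| smooth_powR f s : entire f -> (forall x, 0 <= x -> 0 < psum f x) ->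
    smooth_class (fun x => psum f (x ^+ 2) `^ s)
| smooth_add g h : smooth_class g -> smooth_class h -> smooth_class (fun x => g x + h x)
| smooth_mul g h : smooth_class g -> smooth_class h -> smooth_class (fun x => g x * h x).

Lemma is_derive_psum_sqr f (x : R) : entire f ->
  is_derive x 1 (fun x => psum f (x ^+ 2)) (psum (pseries_diffs f) (x ^+ 2) * (2 * x)).
Proof.
move=> ef; have D1 := is_derive_psum (x ^+ 2) ef.
have D2 : is_derive x 1 (fun x : R => x ^+ 2) (2 * x).
  by apply: is_derive_eq; rewrite /GRing.scale/= mulr1; ring.
exact: (@is_derive1_comp _ (psum f) (fun x => x ^+ 2)).
Qed.

Lemma smooth_class_derive g : smooth_class g ->
  exists g', smooth_class g' /\ forall x : R, is_derive x 1 g (g' x).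
Proof.
elim => [c| |f ef|f s ef f0|g1 h1 _ [g' [sg' dg']] _ [h' [sh' dh']]|
         g1 h1 sg [g' [sg' dg']] sh [h' [sh' dh']]].
- by exists (fun=> 0); split => [|x]; [exact: smooth_cst|exact: is_derive_cst].
- by exists (fun=> 1); split => [|x]; [exact: smooth_cst|exact: is_derive_id].
- exists (fun x => psum (pseries_diffs f) (x ^+ 2) * (2 * x)); split.
    apply: smooth_mul; first by apply: smooth_psum; exact: entire_diffs.
    by apply: smooth_mul; [exact: smooth_cst|exact: smooth_id].
  by move=> x; exact: is_derive_psum_sqr.
- exists (fun x => s * psum f (x ^+ 2) `^ (s - 1) *
                   (psum (pseries_diffs f) (x ^+ 2) * (2 * x))); split.
    apply: smooth_mul.
      by apply: smooth_mul; [exact: smooth_cst|exact: smooth_powR].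
    apply: smooth_mul; first by apply: smooth_psum; exact: entire_diffs.
    by apply: smooth_mul; [exact: smooth_cst|exact: smooth_id].
  move=> x; have D1 := is_derive_psum_sqr x ef.
  have D2 := @is_derive1_powR R s _ (f0 (x ^+ 2) (sqr_ge0 x)).
  exact: (@is_derive1_comp _ (fun y => y `^ s) (fun x => psum f (x ^+ 2)) x _ _ D2 D1).
- exists (fun x => g' x + h' x); split; first exact: smooth_add.
  by move=> x; exact: is_deriveD.
- exists (fun x => g' x * h1 x + g1 x * h' x); split.
    by apply: smooth_add; exact: smooth_mul.
  move=> x; have D1 := dg' x; have D2 := dh' x.
  by apply: is_derive_eq; rewrite /GRing.scale/= addrC [g' x * _]mulrC.
Qed.

End smooth_functions.

(** * Closed form of the integral of the Riccati solution *)

Section riccati.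
Context {R : realType}.
Variables (b theta : R).
Hypotheses (b_gt0 : 0 < b) (theta_gt0 : 0 < theta).
Implicit Types (q t s : R) (k n : nat).

(* With [u t = expR (- b * t) * dser (l2 ^+ 2 * expR (- 2 * theta * t))], the series [dser]
   is the one for which [u'' + b u' = (l2 ^+ 2 / 4) * expR (- 2 * theta * t) * u]: the
   linearisation [v = 2 u' / u] of the Riccati equation.  The companion series [eser]
   gives [- u'] in the same way. *)
Fixpoint dcoef k : R :=
  if k is k'.+1 then dcoef k' / (8 * theta * k%:R * (b + 2 * theta * k%:R)) else 1.

Definition ecoef k : R := b * dcoef k + 2 * theta * (k%:R * dcoef k).

Definition dser := psum dcoef.
Definition eser := psum ecoef.

Let den_gt0 k : 0 < b + 2 * theta * k.+1%:R.
Proof. by rewrite addr_gt0// !mulr_gt0. Qed.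

Lemma dcoef_gt0 k : 0 < dcoef k.
Proof. by elim: k => //= k IH; rewrite divr_gt0// !mulr_gt0. Qed.

(** Dropping [2 * theta * k] from the last factor of the denominator leaves [8 * theta * b * k],
    whose product over [k] is a power times a factorial. *)
Lemma entire_dcoef : entire dcoef.
Proof.
exists 1, (8 * theta * b)^-1; split; rewrite ?invr_ge0 ?mulr_ge0 ?(ltW b_gt0) ?(ltW theta_gt0)//.
move=> k; rewrite mul1r gtr0_norm ?dcoef_gt0//.
elim: k => [|k IH]; first by rewrite expr0 fact0 divr1.
rewrite /= factS natrM exprS.
have -> : (8 * theta * b)^-1 * (8 * theta * b)^-1 ^+ k / (k.+1%:R * k`!%:R) =
    ((8 * theta * b)^-1 ^+ k / k`!%:R) * (8 * theta * b * k.+1%:R)^-1 by rewrite !invfM; ring.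
apply: ler_pM => //; first by apply/ltW/dcoef_gt0.
  by rewrite invr_ge0 !mulr_ge0 ?ltW// den_gt0.
have P1 : 0 < 8 * theta * k.+1%:R * (b + 2 * theta * k.+1%:R) by rewrite !mulr_gt0.
have P2 : 0 < 8 * theta * b * k.+1%:R by rewrite !mulr_gt0.
rewrite lef_pV2 ?posrE//.
rewrite mulrAC ler_wpM2l ?mulr_ge0 ?ltW//.
by rewrite ltrDl !mulr_gt0.
Qed.

Lemma entire_ecoef : entire ecoef.
Proof.
by apply: entireD; apply: entireZ; [|apply: entire_natmul]; exact: entire_dcoef.
Qed.

Lemma is_derive_dser q : is_derive q 1 dser (psum (pseries_diffs dcoef) q).
Proof. exact/is_derive_psum/entire_dcoef. Qed.

(** Together with [eserE] this is the second-order linear equation written as a first-order system;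
    on coefficients it is the recursion defining [dcoef]. *)
Lemma is_derive_eser q : is_derive q 1 eser (dser q / (8 * theta)).
Proof.
have -> : dser q / (8 * theta) = psum (pseries_diffs ecoef) q.
  rewrite mulrC -psumZ; last exact: entire_dcoef.
  congr psum; apply/funext => k; rewrite /pseries_diffs /ecoef /=.
  have n0 : 0 < k.+1%:R :> R by [].
  by have := den_gt0 k; move: k.+1%:R n0 => n n0 h; field; rewrite ?gt_eqF.
exact/is_derive_psum/entire_ecoef.
Qed.

Lemma eserE q : eser q = b * dser q + 2 * theta * (q * psum (pseries_diffs dcoef) q).
Proof.
have ed := entire_dcoef; have en := entire_natmul ed.
by rewrite /eser /ecoef psumD ?psumZ ?psum_natmul//; exact: entireZ.
Qed.

Lemma dser0 : dser 0 = 1.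
Proof. exact: psum0. Qed.

Lemma eser0 : eser 0 = b.
Proof. by rewrite /eser psum0 /ecoef/= mul0r mulr0 addr0 mulr1. Qed.

Lemma ddser0 : psum (pseries_diffs dcoef) 0 = (8 * theta * (b + 2 * theta))^-1.
Proof. by rewrite psum0 /pseries_diffs/= !mulr1 !mul1r. Qed.

Lemma dser_ge q n : 0 <= q -> 1 + dcoef n.+1 * q ^+ n.+1 <= dser q.
Proof.
move=> q0; have [] // := @psum_ge _ dcoef q n entire_dcoef _ q0.
by move=> k; exact/ltW/dcoef_gt0.
Qed.

Lemma dser_ge1 q : 0 <= q -> 1 <= dser q.
Proof.
move=> q0; have [] // := @psum_ge _ dcoef q 0 entire_dcoef _ q0.
by move=> k; exact/ltW/dcoef_gt0.
Qed.

Lemma dser_gt0 q : 0 <= q -> 0 < dser q.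
Proof. by move=> q0; exact: lt_le_trans (dser_ge1 q0). Qed.

(** Later this gives [b <= eser q / dser q], so that the exponential weight in the conditional
    characteristic function is at most 1. *)
Lemma eser_ge q : 0 <= q -> b * dser q <= eser q.
Proof.
move=> q0; rewrite eserE lerDl !mulr_ge0 ?(ltW theta_gt0)//.
have h k : 0 <= pseries_diffs dcoef k by rewrite mulr_ge0//; apply/ltW/dcoef_gt0.
have [+ _] := psum_ge 0 (entire_diffs entire_dcoef) h q0.
by apply: le_trans.
Qed.

Lemma eser_gt0 q : 0 <= q -> 0 < eser q.
Proof. by move=> q0; apply: lt_le_trans (eser_ge q0); rewrite mulr_gt0// dser_gt0. Qed.

Section solution.
Variables (l1 l2 : R) (f : R -> R).
Hypothesis (fsol : nonneg_riccati_solution b theta l1 l2 f).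

Let f_ge0 t : 0 <= t -> 0 <= f t. Proof. by case: fsol => _ + _ _; exact. Qed.
Let f0E : f 0 = l1. Proof. by case: fsol. Qed.
Let df t : 0 < t -> is_derive t 1 f (riccati_rhs b theta l2 f t).
Proof. by case: fsol => _ _ _; exact. Qed.

Let f_right : f x @[x --> 0^'+] --> f 0.
Proof.
have [_ _ + _] := fsol; set L := riccati_rhs _ _ _ _ _ => h.
have hx : (x : R) @[x --> 0^'+] --> 0 by apply: cvg_at_right_filter; exact: cvg_id.
have : f 0 + x * (x^-1 * (f x - f 0)) @[x --> 0^'+] --> f 0 + 0 * L.
  by apply: cvgD; [exact: cvg_cst|exact: cvgM].
rewrite mul0r addr0.
apply: cvg_trans; apply: near_eq_cvg; near=> x => /=.
have x0 : 0 < x by near: x; exact: nbhs_right_gt.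
rewrite mulrA divff ?mul1r ?gt_eqF//.
by rewrite addrC subrK.
Unshelve. all: by end_near. Qed.

Let f_cont t : 0 < t -> {for t, continuous f}.
Proof.
move=> t0; have [d _] := df t0.
exact/differentiable_continuous/derivable1_diffP.
Qed.

Let c := Num.min b theta.

Let c_gt0 : 0 < c. Proof. by rewrite lt_min b_gt0. Qed.

(** The function [k] below is nonincreasing: [c <= b] absorbs the linear term, [c <= theta] bounds
    the forcing term times [expR (c * s)] by a multiple of [expR (- c * s)], and the quadratic term
    has the good sign. *)
Let f_decay t : 0 <= t -> f t <= (l1 + l2 ^+ 2 / (2 * c)) * expR (- (c * t)).
Proof.
move=> t0; pose k s := f s * expR (c * s) + l2 ^+ 2 / (2 * c) * expR (- c * s).
have dexp (r s : R) : is_derive s 1 (fun s => expR (r * s)) (expR (r * s) * r).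
  apply: (@is_derive1_comp _ expR (fun s => r * s)).
  by apply: is_derive_eq; rewrite /GRing.scale/= mulr1.
have dk s : 0 < s -> is_derive s 1 k (riccati_rhs b theta l2 f s * expR (c * s)
    + f s * (expR (c * s) * c) + l2 ^+ 2 / (2 * c) * (expR (- c * s) * - c)).
  move=> s0; have D1 := df s0; have D2 := dexp c s; have D3 := dexp (- c) s.
  by apply: is_derive_eq; rewrite /GRing.scale/=; ring.
have kle : k t <= k 0.
  apply: (@ler0_derive1_nincry _ k 0) => // [s|s|].
  - by rewrite in_itv/= andbT => s0; have [] := dk _ s0.
  - rewrite in_itv/= andbT => s0; rewrite derive1E; have [_ ->] := dk _ s0.
    rewrite /riccati_rhs.
    have fs := f_ge0 (ltW s0); have ec := expR_gt0 (c * s); have ec' := expR_gt0 (- c * s).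
    have cb : c <= b by rewrite ge_min lexx.
    have ct : c <= theta by rewrite ge_min lexx orbT.
    have e2 : expR (- 2 * theta * s) * expR (c * s) <= expR (- c * s).
      by rewrite -expRD ler_expR; nra.
    have -> : l2 ^+ 2 / (2 * c) * (expR (- c * s) * - c) = - (2^-1 * l2 ^+ 2 * expR (- c * s)).
      by field; rewrite gt_eqF.
    have l22 := sqr_ge0 l2.
    have h1 : 0 <= (b - c) * f s * expR (c * s) by rewrite !mulr_ge0 ?subr_ge0// ltW.
    have h2 : 0 <= f s ^+ 2 * expR (c * s) by rewrite !mulr_ge0 ?sqr_ge0// ltW.
    have h3 : 0 <= 2^-1 * l2 ^+ 2 * (expR (- c * s) - expR (- 2 * theta * s) * expR (c * s)).
      by rewrite mulr_ge0 ?subr_ge0// mulr_ge0.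
    nra.
  - apply/continuous_within_itvcyP; split.
      move=> s; rewrite in_itv/= andbT => s0; have [d _] := dk _ s0.
      exact/differentiable_continuous/derivable1_diffP.
    apply: cvgD; first apply: cvgM; first exact: f_right.
      apply: cvg_at_right_filter; apply: continuous_comp; last exact: continuous_expR.
      exact: mulrl_continuous.
    apply: cvgM; first exact: cvg_cst.
    apply: cvg_at_right_filter; apply: continuous_comp; last exact: continuous_expR.
    exact: mulrl_continuous.
have k0 : k 0 = l1 + l2 ^+ 2 / (2 * c) by rewrite /k !mulr0 expR0 !mulr1 f0E.
rewrite -k0 expRN ler_pdivlMr ?expR_gt0//; apply: le_trans kle.
by rewrite lerDl mulr_ge0 ?expR_ge0// divr_ge0 ?sqr_ge0// mulr_ge0// ltW.
Qed.

Let q t := l2 ^+ 2 * expR (- 2 * theta * t).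
Let q_ge0 t : 0 <= q t. Proof. by rewrite mulr_ge0 ?sqr_ge0 ?expR_ge0. Qed.

(** A Wronskian. Let [U] be a solution of the linear equation with [f = 2 U' / U], and [u] the
    decaying solution [expR (- b * t) * dser (q t)]. Then [U' u - U u' = U * expR (- b * t) * K t],
    while by Abel's identity this is a constant times [expR (- b * t)]. So [K] is proportional to
    [1 / U], and [K' = - (f / 2) K]; hence [-2 * ln (K t)] is an antiderivative of [f]. *)
Let K t := eser (q t) + f t * dser (q t) / 2.

Let K_gt0 t : 0 <= t -> 0 < K t.
Proof.
move=> t0; rewrite ltr_pwDl ?eser_gt0// divr_ge0// mulr_ge0 ?f_ge0// ltW//.
exact: dser_gt0.
Qed.

Let dq t : is_derive t 1 q (- 2 * theta * q t).
Proof.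
have D : is_derive t 1 (fun s => expR (- 2 * theta * s)) (expR (- 2 * theta * t) * (- 2 * theta)).
  apply: (@is_derive1_comp _ expR (fun s => - 2 * theta * s)).
  by apply: is_derive_eq; rewrite /GRing.scale/= mulr1.
by apply: is_derive_eq; rewrite /GRing.scale/= /q; ring.
Qed.

Let dK t : 0 < t -> is_derive t 1 K (- (f t / 2) * K t).
Proof.
move=> t0; have D1 := df t0.
have D2 := @is_derive1_comp _ eser q t _ _ (is_derive_eser (q t)) (dq t).
have D3 := @is_derive1_comp _ dser q t _ _ (is_derive_dser (q t)) (dq t).
have -> : K = (fun s => (eser \o q) s + 2^-1 * (f s * (dser \o q) s)).
  by apply/funext => s; rewrite /K/= [2^-1 * _]mulrC.
apply: is_derive_eq; rewrite /GRing.scale/=.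
have E := eserE (q t); rewrite /riccati_rhs.
have qE : 2^-1 * expR (- 2 * theta * t) * l2 ^+ 2 = q t / 2 by rewrite /q; ring.
rewrite qE E; field.
by rewrite gt_eqF.
Qed.

Let cvg_expN (r : R) : 0 < r -> expR (- (r * x)) @[x --> +oo] --> 0.
Proof.
move=> r0; apply: (cvg_comp _ _ _ (@cvgr_expR R)).
by apply: gt0_cvgMry => //; exact: cvg_id.
Qed.

Lemma integral_riccati :
  \int[lebesgue_measure]_(s in `[0, +oo[) f s =
  2 * ln ((eser (l2 ^+ 2) + l1 * dser (l2 ^+ 2) / 2) / b).
Proof.
have K0 : K 0 = eser (l2 ^+ 2) + l1 * dser (l2 ^+ 2) / 2.
  by rewrite /K /q mulr0 expR0 mulr1 f0E.
pose F t := -2 * ln (K t).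
have dser_cont x : {for x, continuous dser}.
  by apply/differentiable_continuous/derivable1_diffP; have [] := is_derive_dser x.
have eser_cont x : {for x, continuous eser}.
  by apply/differentiable_continuous/derivable1_diffP; have [] := is_derive_eser x.
(* One limit computation for both ends of the half-line: at infinity [q] and [f] tend to 0, so [K]
   tends to [eser 0 = b]; at 0 from the right it gives continuity of the antiderivative. *)
have ln_K (G : set_system R) (FG : Filter G) (x p : R) : q s @[s --> G] --> x ->
    f s @[s --> G] --> p -> 0 < eser x + p * dser x / 2 ->
    F s @[s --> G] --> -2 * ln (eser x + p * dser x / 2).
  move=> qx fp pos; apply: cvgMr; apply: (continuous_cvg _ (continuous_ln pos)).
  apply: cvgD; first exact: (continuous_cvg _ (eser_cont x)).
  by apply: cvgMl; apply: cvgM => //; exact: (continuous_cvg _ (dser_cont x)).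
have Foo : F t @[t --> +oo] --> -2 * ln b.
  have -> : b = eser 0 + 0 * dser 0 / 2 by rewrite eser0 !mul0r addr0.
  apply: ln_K.
  - rewrite -[X in _ --> X](mulr0 (l2 ^+ 2)); apply: cvgMr.
    have := @cvg_expN (2 * theta) (mulr_gt0 _ theta_gt0); rewrite ltr0n => /(_ isT).
    by under eq_fun do rewrite -mulNr -[- (2 * theta)]mulNr.
  - apply: (@squeeze_cvgr _ _ _ _ (cst 0) (fun t => (l1 + l2 ^+ 2 / (2 * c)) * expR (- (c * t)))).
    + near=> t; have t0 : 0 <= t by near: t; apply: nbhs_pinfty_ge; rewrite num_real.
      by rewrite f_ge0//= f_decay.
    + exact: cvg_cst.
    + by rewrite -[X in _ --> X](mulr0 (l1 + l2 ^+ 2 / (2 * c))); apply: cvgMr; exact: cvg_expN.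
  - by rewrite eser0 !mul0r addr0.
have dF t : 0 < t -> is_derive t 1 F (f t).
  move=> t0; have Kt := K_gt0 (ltW t0).
  have D := @is_derive1_comp _ (fun y => ln y) K t _ _ (is_derive1_ln Kt) (dK t0).
  have -> : F = (fun s => -2 * ((fun y => ln y) \o K) s) by [].
  by apply: is_derive_eq; rewrite /GRing.scale/=; field; rewrite gt_eqF.
rewrite (@Rintegral_ge0_continuous_FTC2y _ f F 0 (-2 * ln b)) => //.
- rewrite /F K0 lnM ?posrE ?invr_gt0 -?K0 ?K_gt0// lnV ?posrE//; ring.
- apply/continuous_within_itvcyP; split; last exact: f_right.
  by move=> s; rewrite in_itv/= andbT => /f_cont.
- by move=> t /dF[].
- rewrite /F {2}/K; apply: ln_K; [|exact: f_right|exact: K_gt0].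
  apply: cvgMr; apply: cvg_at_right_filter; apply: continuous_comp; last exact: continuous_expR.
  exact: mulrl_continuous.
- by move=> s; rewrite in_itv/= andbT => s0; rewrite derive1E; have [_] := dF _ s0.
Unshelve. all: by end_near. Qed.

End solution.
End riccati.

(** * The Gamma density *)

Section lebesgue_dilation.
Context {R : realType}.
Local Notation leb := (@lebesgue_measure R).

Let measurable_dilation (r : R) :
  measurable_fun [set: R] ((fun x => r * x) : R -> measurableTypeR R).
Proof. exact: mulrl_measurable. Qed.

Let dilated (r : R) (r0 : 0 <= r) : {measure set (measurableTypeR R) -> \bar R} :=
  mscale (NngNum r0) (measure_function_pushforward__canonical__measure_function_Measure leb (measurable_dilation r)).

(** Lebesgue measure is characterised by its values on half-open intervals, where the scaling is
    explicit. *)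
Lemma lebesgue_measure_dilation (r : R) (A : set R) : 0 < r -> measurable A ->
  leb A = (r%:E * leb ((fun x : R => (r * x)%R) @^-1` A))%E.
Proof.
move=> r0 mA.
apply: (@lebesgue_measure_unique R (dilated (ltW r0))) => // _ [[a b]] _ <-.
transitivity (r%:E * leb ((fun x : R => (r * x)%R) @^-1` `]a, b]))%E; last by [].
rewrite (_ : (fun x : R => r * x) @^-1` _ = `]a / r, b / r]%classic); last first.
  apply/seteqP; split => x /=; rewrite !in_itv/= => /andP[h1 h2]; apply/andP; split.
  - by rewrite ltr_pdivrMr// mulrC.
  - by rewrite ler_pdivlMr// mulrC.
  - by move: h1; rewrite ltr_pdivrMr// mulrC.
  - by move: h2; rewrite ler_pdivlMr// mulrC.
rewrite !lebesgue_measure_itv/= !lte_fin ltr_pM2r ?invr_gt0//.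
case: ifPn => _; last by rewrite mule0.
by rewrite -!EFinB -EFinM -mulrBl mulrCA divff ?mulr1 ?gt_eqF.
Qed.

Lemma ge0_integral_dilation (r : R) (f : R -> \bar R) : 0 < r ->
  measurable_fun setT f -> (forall x, 0 <= f x)%E ->
  (\int[leb]_x f x = r%:E * \int[leb]_x f (r * x)%R)%E.
Proof.
move=> r0 mf f0.
rewrite (@eq_measure_integral _ _ _ _ (dilated (ltW r0))); last first.
  by move=> A mA _; exact: lebesgue_measure_dilation.
rewrite ge0_integral_mscale; [|exact: measurableT|exact: mf|by move=> x _; exact: f0].
congr (_ * _)%E; rewrite ge0_integral_pushforward; last 3 first.
- exact: measurableT.
- exact: mf.
- by move=> x _; exact: f0.
by rewrite preimage_setT.
exact: measurable_dilation.
Qed.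

End lebesgue_dilation.

Section gamma.
Context {R : realType}.
Local Notation leb := (@lebesgue_measure R).
Variables (s : R) (s_gt0 : 0 < s).

Definition gamma_weight (r x : R) : R :=
  ((fun x => x `^ (s - 1) * expR (- r * x)) \_ `]0, +oo[) x.

Lemma gamma_weightE (r x : R) : gamma_weight r x =
  if 0 < x then x `^ (s - 1) * expR (- r * x) else 0.
Proof.
rewrite /gamma_weight patchE.
by case: ifPn; rewrite ?inE ?notin_setE/= in_itv/= andbT; [move=> ->|move/negP/negbTE ->].
Qed.

Lemma gamma_weight_ge0 (r x : R) : 0 <= gamma_weight r x.
Proof. by rewrite gamma_weightE; case: ifP => // _; rewrite mulr_ge0 ?powR_ge0 ?expR_ge0. Qed.

Lemma measurable_gamma_weight (r : R) : measurable_fun setT (gamma_weight r).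
Proof.
apply/(measurable_restrictT _ _).1 => //; apply: measurable_funTS.
apply: measurable_funM; first exact: measurable_powR.
by apply: measurableT_comp => //; exact: mulrl_measurable.
Qed.

Lemma integral_gamma_weight (r : R) : 0 < r ->
  (\int[leb]_x (gamma_weight r x)%:E =
   (r `^ (- s))%:E * \int[leb]_x (gamma_weight 1 x)%:E)%E.
Proof.
move=> r0; have mw q : measurable_fun setT (fun x => (gamma_weight q x)%:E).
  by apply/measurable_EFinP; exact: measurable_gamma_weight.
rewrite (@ge0_integral_dilation R r^-1) ?invr_gt0//; last first.
  by move=> x; rewrite lee_fin gamma_weight_ge0.
transitivity (r^-1%:E * \int[leb]_x ((r `^ (1 - s))%:E * (gamma_weight 1 x)%:E))%E.
  congr (_ * _)%E; apply: eq_integral => x _.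
  rewrite -EFinM !gamma_weightE pmulr_rgt0 ?invr_gt0//.
  case: ifPn => x0; last by rewrite mulr0.
  rewrite powRM ?invr_ge0 ?ltW// -mulrA; congr (_ * (_ * expR _))%:E.
    by rewrite -powR_inv1 ?ltW// -powRrM; congr (_ `^ _); ring.
  by rewrite mulrA mulNr divff ?gt_eqF.
rewrite ge0_integralZl//; last 3 first.
- exact: mw.
- by move=> x _; rewrite lee_fin gamma_weight_ge0.
- by rewrite lee_fin powR_ge0.
rewrite muleA -EFinM -powR_inv1 ?ltW// -powRD; last by rewrite (gt_eqF r0) implybT.
by congr ((_ `^ _)%:E * _)%E; ring.
Qed.

(** Half of the exponential decay is spent on absorbing the power of [x]. *)
Lemma gamma_weight_le : exists C : R, 0 < C /\ forall x, 1 <= x ->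
  gamma_weight 1 x <= C * expR (- (x / 2)).
Proof.
have [n sn] : exists n : nat, s - 1 <= n.+1%:R.
  by exists (Num.truncn s); rewrite (le_trans _ (ltW (truncnS_gt s)))// gerBl.
exists (2 ^+ n.+1 * (n.+1)`!%:R); split; first by rewrite mulr_gt0 ?exprn_gt0// ltr0n fact_gt0.
move=> x x1; have x0 : 0 < x by exact: lt_le_trans x1.
rewrite gamma_weightE x0.
have -> : - 1 * x = - (x / 2) + - (x / 2) by field.
rewrite expRD mulrA ler_wpM2r ?expR_ge0// expRN ler_pdivrMr ?expR_gt0//.
apply: le_trans (ler_powR x1 sn) _; rewrite powR_mulrn ?(ltW x0)//.
have h : (x / 2) ^+ n.+1 / (n.+1)`!%:R <= expR (x / 2).
  have := @expR_ge1Dxn R (x / 2) n (ltW _); rewrite divr_gt0// => /(_ isT).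
  by apply: le_trans; rewrite lerDr.
rewrite -ler_pdivrMl ?mulr_gt0 ?exprn_gt0 ?ltr0n ?fact_gt0//; apply: le_trans h.
by rewrite le_eqVlt; apply/orP; left; apply/eqP; rewrite expr_div_n invfM; ring.
Qed.

Lemma integrable_gamma_weight1 : leb.-integrable setT (EFin \o gamma_weight 1).
Proof.
have mw : measurable_fun setT (gamma_weight 1) by exact: measurable_gamma_weight.
(* near 0: compare with [x `^ (s - 1)], the derivative of [x `^ s / s] *)
have near0 : leb.-integrable setT (EFin \o ((fun x : R => x `^ (s - 1)) \_ `]0, 1])).
  pose f_ n := (fun x : R => x `^ (s - 1)) \_ `[n.+1%:R^-1, 1].
  have F n : leb.-integrable setT (EFin \o f_ n) /\
      \int[leb]_x f_ n x = s^-1 * (1 - n.+1%:R^-1 `^ s).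
    have n0 : 0 < n.+1%:R^-1 :> R by rewrite invr_gt0.
    have n1 : n.+1%:R^-1 <= 1 :> R by rewrite invf_le1// ler1n.
    have cf : {within `[n.+1%:R^-1, 1], continuous (fun x : R => x `^ (s - 1))}.
      apply: continuous_in_subspaceT => x; rewrite inE/= in_itv/= => /andP[nx _].
      have x0 : 0 < x by exact: lt_le_trans nx.
      apply/differentiable_continuous/derivable1_diffP/derivable_powR.
      by rewrite in_itv/= x0.
    split.
      apply/(intg_restrict _ _).1 => //.
      by apply: continuous_compact_integrable cf; exact: segment_compact.
    rewrite -Rintegral_mkcond; move: n1; rewrite le_eqVlt => /predU1P[n1|n1].
      by rewrite n1 set_itv1 Rintegral_set1 powR1 subrr mulr0.
    have dF (x : R) : 0 < x -> is_derive x 1 (fun x : R => s^-1 * x `^ s) (x `^ (s - 1)).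
      move=> x0; have D := is_derive1_powR s x0.
      by apply: is_derive_eq; rewrite /GRing.scale/= mulrA mulVf ?mul1r ?gt_eqF.
    have cF (x : R) : 0 < x -> {for x, continuous (fun x : R => s^-1 * x `^ s)}.
      by move=> x0; apply/differentiable_continuous/derivable1_diffP; have [] := dF x x0.
    rewrite /Rintegral (@continuous_FTC2 _ _ (fun x => s^-1 * x `^ s) _ _ n1 cf).
    - by rewrite /= powR1; ring.
    - split.
      + move=> x; rewrite in_itv/= => /andP[nx _]; have [] // := dF x.
        exact: lt_trans nx.
      + by apply: cvg_at_right_filter; exact: cF.
      + by apply: cvg_at_left_filter; exact: cF.
    - move=> x; rewrite in_itv/= => /andP[nx _]; rewrite derive1E.
      by have [|_ ->//] := dF x; exact: lt_trans nx.
  have [] // := @increasing_approx_cvg _ _ R leb f_ ((fun x : R => x `^ (s - 1)) \_ `]0, 1]) s^-1.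
  - move=> n; exact: intg_measurable (F n).1.
  - move=> x; apply: cvg_near_cst.
    have [x0|x0] := ltP 0 x.
      near=> n; rewrite /f_ !patchE; congr (if _ then _ else _).
      have nx : n.+1%:R^-1 < x by near: n; exact: near_infty_natSinv_lt (PosNum x0).
      by apply/idP/idP; rewrite !inE/= !in_itv/= (ltW nx) x0.
    near=> n; rewrite /f_ !patchE !ifF//; apply/negbTE; rewrite notin_setE/= in_itv/=.
      by move=> /andP[h _]; move: x0; rewrite leNgt h.
    move=> /andP[h _]; move: x0; rewrite leNgt; move/negP; apply.
    by apply: lt_le_trans h; rewrite invr_gt0.
  - move=> n x; rewrite /f_ !patchE.
    case: ifPn => [|_]; last by rewrite lexx/=; case: ifP => // _; exact: powR_ge0.
    rewrite inE/= in_itv/= => /andP[nx x1]; rewrite powR_ge0/= ifT//.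
    by rewrite inE/= in_itv/= x1 andbT; apply: lt_le_trans nx; rewrite invr_gt0.
  - by move=> n; have [] := F n.
  - rewrite (_ : (fun n => \int[leb]_x f_ n x) = (fun n => s^-1 * (1 - n.+1%:R^-1 `^ s))); last first.
      by apply/funext => n; exact: (F n).2.
    rewrite -[X in _ --> X]mulr1 -[X in _ * X](subr0 1); apply: cvgMr.
    apply: cvgB; first exact: cvg_cst.
    have /cvg_at_rightP := powR_cvg0 s_gt0; apply.
    by split => [n|]; [rewrite invr_gt0|exact: cvg_harmonic].
(* Near infinity: compare with [expR (- (x / 2))], the derivative of [-2 * expR (- (x / 2))]. *)
have [C [C0 hC]] := gamma_weight_le.
have neary : leb.-integrable setT (EFin \o ((fun x : R => expR (- (x / 2))) \_ `[1, +oo[)).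
  apply/(intg_restrict _ _).1 => //; apply/integrableP; split.
    apply/measurable_EFinP; apply: measurable_funTS; apply: measurableT_comp => //.
    by apply: measurableT_comp => //; exact: mulrr_measurable.
  have cont (x : R) : {for x, continuous (fun x : R => expR (- (x / 2)))}.
    apply: continuous_comp; last exact: continuous_expR.
    by apply: continuousN; exact: mulrr_continuous.
  have dF (x : R) : is_derive x 1 (fun x : R => -2 * expR (- (x / 2))) (expR (- (x / 2))).
    have D : is_derive x 1 (fun x : R => expR (- (x / 2))) (expR (- (x / 2)) * - 2^-1).
      apply: (@is_derive1_comp _ expR (fun x : R => - (x / 2))).
      by apply: is_derive_eq; rewrite /GRing.scale/=; ring.
    by apply: is_derive_eq; rewrite /GRing.scale/=; field.
  apply: (@le_lt_trans _ _ (\int[leb]_(x in `[1%R, +oo[) (expR (- (x / 2)))%:E)%E).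
    rewrite le_eqVlt; apply/orP; left; apply/eqP; apply: eq_integral => x _ /=.
    by rewrite ger0_norm ?expR_ge0.
  rewrite (@ge0_continuous_FTC2y _ _ (fun x : R => -2 * expR (- (x / 2))) 1 0).
  - by rewrite -EFinB ltry.
  - by move=> x _; exact: expR_ge0.
  - by apply: continuous_subspaceT => x; exact: cont.
  - rewrite -[X in _ --> X](mulr0 (-2)); apply: cvgMr.
    apply: (cvg_comp _ _ _ (@cvgr_expR R)).
    by apply: gt0_cvgMly => //; exact: cvg_id.
  - by move=> x _; have [] := dF x.
  - apply: cvg_at_right_filter; apply: cvgMr; exact: cont.
  - by move=> x _; rewrite derive1E; have [_ ->] := dF x.
pose g (x : R) := ((fun x : R => x `^ (s - 1)) \_ `]0, 1]) x +
     C * ((fun x : R => expR (- (x / 2))) \_ `[1, +oo[) x.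
apply: (@le_intg _ (measurableTypeR R) R leb (gamma_weight 1) g) => //.
- move=> x; rewrite /g ger0_norm ?gamma_weight_ge0// !patchE.
  have p1 : 0 <= (if x \in `]0, 1]%classic then x `^ (s - 1) else 0).
    by case: ifP => // _; exact: powR_ge0.
  have p2 : 0 <= C * (if x \in `[1, +oo[%classic then expR (- (x / 2)) else 0).
    by rewrite mulr_ge0 ?(ltW C0)//; case: ifP => // _; exact: expR_ge0.
  have [x1|x1] := leP 1 x.
    apply: (le_trans (hC x x1)); rewrite [in leRHS](_ : (x \in `[1, +oo[%classic) = true).
      by rewrite lerDr.
    by apply/mem_set; rewrite /= in_itv/= x1.
  have [x0|x0] := ltP 0 x; last by rewrite gamma_weightE ltNge x0/= addr_ge0.
  rewrite gamma_weightE x0 [in leRHS](_ : (x \in `]0, 1]%classic) = true).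
    rewrite -[leLHS]addr0 lerD// ler_piMr ?powR_ge0// expR_le1 mulNr mul1r oppr_le0 ltW//.
  by apply/mem_set; rewrite /= in_itv/= x0 ltW.
- have := integrableD measurableT near0 (integrableZl measurableT C neary).
  by apply: eq_integrable => // x _; rewrite /= EFinD EFinM.
Unshelve. all: by end_near. Qed.

Lemma integrable_gamma_weight (r : R) : 0 < r -> leb.-integrable setT (EFin \o gamma_weight r).
Proof.
move=> r0; apply/integrableP; split; first by apply/measurable_EFinP; exact: measurable_gamma_weight.
apply: (@le_lt_trans _ _ (\int[leb]_x (gamma_weight r x)%:E)%E).
  rewrite le_eqVlt; apply/orP; left; apply/eqP; apply: eq_integral => x _ /=.
  by rewrite ger0_norm ?gamma_weight_ge0.
rewrite integral_gamma_weight// -ge0_fin_numE; last first.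
  by rewrite mule_ge0 ?lee_fin ?powR_ge0// integral_ge0// => x _; rewrite lee_fin gamma_weight_ge0.
by rewrite fin_numM//; exact: (integrable_fin_num measurableT integrable_gamma_weight1).
Qed.

Lemma gamma_funE : gamma_fun s = \int[leb]_x gamma_weight 1 x.
Proof.
rewrite /gamma_fun Rintegral_mkcond; apply: eq_Rintegral => x _.
by rewrite gamma_weightE patchE mulN1r;
  case: ifPn; rewrite ?inE ?notin_setE/= in_itv/= andbT; [move=> ->|move/negP/negbTE ->].
Qed.

Lemma gamma_fun_gt0 : 0 < gamma_fun s.
Proof.
rewrite gamma_funE; set c := expR (- `|s - 1| - 2).
have ic : leb.-integrable setT (EFin \o (cst c \_ `[1, 2])).
  apply/(intg_restrict _ _).1 => //.
  by apply: continuous_compact_integrable; [exact: segment_compact|exact: cst_continuous].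
apply: (@lt_le_trans _ _ (\int[leb]_x (cst c \_ `[1, 2]) x)).
  have L : leb `[1, 2]%classic = 1%:E.
    by rewrite lebesgue_measure_itv/= lte_fin ltr1n -EFinB; congr EFin; lra.
  rewrite -Rintegral_mkcond Rintegral_cst//= (_ : fine _ = 1) ?mulr1 ?expR_gt0//.
  exact: (congr1 fine L).
apply: le_Rintegral => //; first exact: integrable_gamma_weight1.
move=> x _; rewrite patchE; case: ifPn => [|_]; last exact: gamma_weight_ge0.
rewrite inE/= in_itv/= => /andP[x1 x2]; have x0 : 0 < x by exact: lt_le_trans x1.
rewrite gamma_weightE x0 /powR gt_eqF// -expRD ler_expR mulN1r lerD//; last by rewrite lerN2.
have l0 : 0 <= ln x by exact: ln_ge0.
have l1 : ln x <= 1.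
  have -> : x = 1 + (x - 1) by ring.
  by apply: le_trans (le_ln1Dx _) _; lra.
rewrite lerNl (le_trans (ler_norm _))// normrN normrM (ger0_norm l0).
by rewrite ler_piMr.
Qed.

Lemma gamma_pdfE (r x : R) : gamma_pdf s r x = r `^ s / gamma_fun s * gamma_weight r x.
Proof.
rewrite /gamma_pdf gamma_weightE patchE.
by case: ifPn; rewrite ?inE ?notin_setE/= in_itv/= andbT;
  [move=> ->; rewrite !mulrA|move/negP/negbTE ->; rewrite mulr0].
Qed.

Lemma integrable_gamma_pdf (r : R) : 0 < r -> leb.-integrable setT (EFin \o gamma_pdf s r).
Proof.
move=> r0; rewrite (_ : EFin \o _ = (fun x => (r `^ s / gamma_fun s)%:E * (gamma_weight r x)%:E)%E).
  exact: (integrableZl _ _ (integrable_gamma_weight r0)).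
by apply/funext => x /=; rewrite gamma_pdfE EFinM.
Qed.

(** The absolute value changes nothing on the support of the density, but makes the variable
    nonnegative everywhere, as [laplace_unique] requires. *)
Lemma gamma_pdf_laplace (r l : R) : 0 < r -> 0 <= l ->
  \int[leb]_x (gamma_pdf s r x * expR (- (l * `|x|))) = (1 + l / r) `^ (- s).
Proof.
move=> r0 l0; have rl0 : 0 < r + l by rewrite ltr_wpDr.
transitivity (\int[leb]_x (r `^ s / gamma_fun s * gamma_weight (r + l) x)).
  apply: eq_Rintegral => x _; rewrite gamma_pdfE !gamma_weightE.
  case: ifP => x0; last by rewrite !mulr0 mul0r.
  rewrite gtr0_norm// -!mulrA; congr (_ * (_ * (_ * _))).
  by rewrite -expRD; congr expR; ring.
rewrite RintegralZl//; last exact: integrable_gamma_weight.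
rewrite [X in _ * X]/Rintegral integral_gamma_weight//.
rewrite -[X in (_ * X)%E]fineK; last exact: (integrable_fin_num measurableT integrable_gamma_weight1).
rewrite -EFinM /= -[fine _]/(\int[leb]_x gamma_weight 1 x) -gamma_funE.
rewrite mulrCA -!mulrA mulVf ?mulr1 ?gt_eqF ?gamma_fun_gt0//.
have -> : 1 + l / r = (r + l) / r by field; rewrite gt_eqF.
rewrite powRM ?invr_ge0 ?ltW//; congr (_ * _).
by rewrite -powR_inv1 ?ltW// -powRrM mulN1r opprK.
Qed.

End gamma.

(** * Domination of measures tested on rectangles *)

Section dyadic_approximation.
Context {R : realType}.
Local Notation plane := (measurableTypeR R * measurableTypeR R)%type.
Implicit Types (A B F : set plane) (N : nat) (x y : R).

(** Membership depends on [x] only through its dyadic cell of length [2 ^- N], and on [y]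
    arbitrarily: such a set is a countable disjoint union of rectangles with a dyadic interval as
    second side. *)
Definition dyadic N (F : set plane) := forall y x x',
  Num.floor (2 ^+ N * x) = Num.floor (2 ^+ N * x') -> F (y, x) -> F (y, x').

Lemma dyadicS N F : dyadic N F -> dyadic N.+1 F.
Proof.
move=> dF y x x' e; apply: dF.
have h (z z' : R) : Num.floor (2 ^+ N.+1 * z) = Num.floor (2 ^+ N.+1 * z') ->
    (Num.floor (2 ^+ N * z) <= Num.floor (2 ^+ N * z')).
  move=> ezz'; rewrite floor_ge_int.
  rewrite -(@ler_pM2l _ 2)// mulrA -exprS.
  have -> : 2 * (Num.floor (2 ^+ N * z))%:~R = (2 * Num.floor (2 ^+ N * z))%:~R :> R.
    by rewrite intrM.
  rewrite -floor_ge_int -ezz' floor_ge_int intrM exprS -mulrA ler_pM2l//.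
  exact: floor_le.
by apply/eqP; rewrite eq_le !h.
Qed.

Lemma dyadic_le N M F : (N <= M)%N -> dyadic N F -> dyadic M F.
Proof.
move=> /subnK <- dF; elim: (M - N)%N => [//|k IH]; rewrite addSn; exact: dyadicS.
Qed.

Lemma dyadicC N F : dyadic N F -> dyadic N (~` F).
Proof. by move=> dF y x x' e nF /dF h; apply: nF; exact: h. Qed.

Lemma dyadicU N F G : dyadic N F -> dyadic N G -> dyadic N (F `|` G).
Proof. by move=> dF dG y x x' e [/(dF _ _ _ e)|/(dG _ _ _ e)]; [left|right]. Qed.

Definition symdiff A B : set plane := (A `\` B) `|` (B `\` A).

Lemma measurable_symdiff A B : measurable A -> measurable B -> measurable (symdiff A B).
Proof. by move=> mA mB; apply: measurableU; exact: measurableD. Qed.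

Variable sigma : {measure set plane -> \bar R}.
Hypothesis sigma_fin : (sigma setT < +oo)%E.

Definition approximable A := measurable A /\ forall e : R, 0 < e -> exists N F,
  [/\ measurable F, dyadic N F & (sigma (symdiff A F) < e%:E)%E].

Lemma approximable_dyadic N F : measurable F -> dyadic N F -> approximable F.
Proof.
move=> mF dF; split=> // e e0; exists N, F; split=> //.
by rewrite /symdiff setDv setU0 measure0 lte_fin.
Qed.

Lemma approximableC A : approximable A -> approximable (~` A).
Proof.
move=> [mA aA]; split; first exact: measurableC.
move=> e /aA[N [F [mF dF h]]]; exists N, (~` F); split.
- exact: measurableC.
- exact: dyadicC.
- rewrite (_ : symdiff _ _ = symdiff A F)//.
  by apply/seteqP; split => x; rewrite /symdiff/=;
    case: (pselect (A x)); case: (pselect (F x)); tauto.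
Qed.

Lemma approximableU A B : approximable A -> approximable B -> approximable (A `|` B).
Proof.
move=> [mA aA] [mB aB]; split; first exact: measurableU.
move=> e e0; have e2 : 0 < e / 2 by rewrite divr_gt0.
have [N [F [mF dF hF]]] := aA _ e2; have [M [G [mG dG hG]]] := aB _ e2.
exists (maxn N M), (F `|` G); split.
- exact: measurableU.
- by apply: dyadicU; [apply: dyadic_le dF; exact: leq_maxl|apply: dyadic_le dG; exact: leq_maxr].
- have mFA := measurable_symdiff mA mF; have mGB := measurable_symdiff mB mG.
  apply: (@le_lt_trans _ _ (sigma (symdiff A F `|` symdiff B G))).
    apply: le_measure; rewrite ?inE.
    + by apply: measurable_symdiff; exact: measurableU.
    + exact: measurableU.
    + by move=> x; rewrite /symdiff/=; tauto.
  apply: le_lt_trans (measureU2 _ mFA mGB) _.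
  by rewrite [e]splitr EFinD; exact: lteD.
Qed.

(** Finiteness of [sigma] lets a finite union exhaust the countable one up to [e / 2]; the finite
    union is then approximated up to [e / 2]. *)
Lemma approximable_bigcup (A : nat -> set plane) :
  (forall n, approximable (A n)) -> approximable (\bigcup_n A n).
Proof.
move=> aA; pose B n := \big[setU/set0]_(k < n) A k.
have aB n : approximable (B n).
  rewrite /B; elim: n => [|n IH].
    by rewrite big_ord0; apply: (@approximable_dyadic 0).
  by rewrite big_ord_recr/=; exact: approximableU.
have mA n := (aA n).1; have mB n := (aB n).1.
have mU : measurable (\bigcup_n A n) by exact: bigcup_measurable.
split=> // e e0; have e2 : 0 < e / 2 by rewrite divr_gt0.
have cv : sigma ((\bigcup_n A n) `\` B n) @[n --> \oo] --> 0%E.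
  have -> : 0%E = sigma (\bigcap_n ((\bigcup_n A n) `\` B n)).
    rewrite (_ : \bigcap_n _ = set0) ?measure0//; apply/seteqP; split => // x h.
    have [[k _ Ak] _] := h 0%N I; have [_] := h k.+1 I; apply.
    by rewrite /B big_ord_recr/=; right.
  apply: nonincreasing_cvg_mu.
  - apply: le_lt_trans sigma_fin; apply: le_measure; rewrite ?inE//.
    exact: measurableD.
  - by move=> n; exact: measurableD.
  - by apply: bigcapT_measurable => n; exact: measurableD.
  - move=> n m nm; apply/subsetPset; apply: setDS.
    exact: subset_bigsetU.
have [n hn] : exists n, (sigma ((\bigcup_n A n) `\` B n) < (e / 2)%:E)%E.
  have /fine_cvgP[fN /cvgr_lt cN] := cv.
  near \oo => n; exists n.
  have fn : sigma ((\bigcup_n A n) `\` B n) \is a fin_num by near: n.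
  by rewrite -(fineK fn) lte_fin; near: n; exact: cN.
have [N [F [mF dF hF]]] := (aB n).2 _ e2.
exists N, F; split=> //.
have mBF := measurable_symdiff (mB n) mF.
apply: (@le_lt_trans _ _ (sigma ((\bigcup_n A n) `\` B n `|` symdiff (B n) F))).
  apply: le_measure; rewrite ?inE.
  - exact: measurable_symdiff.
  - by apply: measurableU => //; exact: measurableD.
  - move=> x; rewrite /symdiff /setU /setD /mkset.
    have : B n x -> (\bigcup_n A n) x by rewrite /B -bigcup_mkord => -[k _ Ak]; exists k.
    by case: (pselect (B n x)); tauto.
apply: le_lt_trans (measureU2 _ _ mBF) _; first exact: measurableD.
by rewrite [e]splitr EFinD; exact: lteD.
Unshelve. all: by end_near. Qed.

(** With [B] fixed, the sets [C] that work form a sigma-algebra, so open half-lines suffice. *)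
Lemma approximable_rectangle (B C : set R) :
  measurable B -> measurable C -> approximable (B `*` C).
Proof.
move=> mB mC.
suff h : <<s @RGenOInfty.G R>> `<=` [set C : set R | approximable (B `*` C)].
  exact: h (eq_ind _ (fun M => M C) mC _ (RGenOInfty.measurableE R)).
apply: smallest_sub.
  split => /=.
  - by rewrite setX0; exact: (@approximable_dyadic 0).
  - move=> D aD; rewrite setTD.
    (* The complement has to be taken inside [B], and is rewritten with unions and full complements
       only. *)
    rewrite (_ : B `*` ~` D = ~` ((~` (B `*` setT)) `|` (B `*` D))).
      apply: approximableC; apply: approximableU => //; apply: approximableC.
      by apply: (@approximable_dyadic 0) => //; exact: measurableX.
    apply/seteqP; split => -[y x] /=; first tauto.
    by case: (pselect (B y)); tauto.
  - move=> D aD; rewrite (_ : B `*` _ = \bigcup_k (B `*` D k)).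
      exact: approximable_bigcup.
    by apply/seteqP; split => -[y x] [] /=; [move=> By [k _ Dk]; exists k|move=> k _ [By Dk]; split=> //; exists k].
move=> _ [u ->] /=.
(* The first point of the grid of mesh [2 ^- N] strictly above [u]; it exceeds [u] by at most one
   mesh, so the half-lines from [r N] fill up the one from [u]. *)
pose r N : R := (Num.floor (2 ^+ N * u) + 1)%:~R / 2 ^+ N.
have p2 N : 0 < 2 ^+ N :> R by rewrite exprn_gt0.
rewrite (_ : B `*` _ = \bigcup_N (B `*` `[r N, +oo[)).
  apply: approximable_bigcup => N; apply: (@approximable_dyadic N).
    by apply: measurableX => //; exact: measurable_itv.
  move=> y x x' e /= [By]; rewrite /= !in_itv/= !andbT /r !ler_pdivrMr// ![_ * 2 ^+ N]mulrC.
  by rewrite -!floor_ge_int e; split.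
apply/seteqP; split => -[y x] /=.
  move=> [By]; rewrite in_itv/= andbT => ux.
  have [N hN] : exists N, 2 ^- N < x - u.
    have xu0 : 0 < x - u by rewrite subr_gt0.
    near \oo => N; exists N.
    have : N.+1%:R^-1 < x - u by near: N; exact: (near_infty_natSinv_lt (PosNum xu0)).
    apply: le_lt_trans; rewrite lef_pV2 ?posrE// -natrX ler_nat.
    exact: ltn_expl.
  exists N => //; split => //=; rewrite in_itv/= andbT /r ler_pdivrMr// intrD.
  have := floor_le (2 ^+ N * u); have := ltW hN.
  rewrite -(ler_pM2l (p2 N)) divff ?gt_eqF// mulrBr [x * _]mulrC; lra.
move=> [N _ [By]] /=; rewrite !in_itv/= !andbT => h; split=> //; apply: lt_le_trans h.
rewrite /r ltr_pdivlMr// mulrC.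
by have /andP[] := floor_itv (2 ^+ N * u).
Unshelve. all: by end_near. Qed.

Lemma measurable_approximable A : measurable A -> approximable A.
Proof.
rewrite measurable_prod_measurableType; apply: smallest_sub.
  split => /=.
  - exact: (@approximable_dyadic 0).
  - by move=> D aD; rewrite setTD; exact: approximableC.
  - exact: approximable_bigcup.
move=> _ [B mB [C mC <-]]; exact: approximable_rectangle.
Qed.

End dyadic_approximation.

Section rectangle_domination.
Context {R : realType}.
Local Notation plane := (measurableTypeR R * measurableTypeR R)%type.
Variables mu nu : {measure set plane -> \bar R}.
Hypotheses (mu_fin : (mu setT < +oo)%E) (nu_fin : (nu setT < +oo)%E).
Hypothesis mu_le : forall (B : set R) (u v : R), measurable B -> u <= v ->
  (mu (B `*` `[u, v[) <= nu (B `*` `[u, v[))%E.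

(** The hypothesis on rectangles is summed over the cells of the grid. *)
Let dyadic_le_measure N (F : set plane) : measurable F -> dyadic N F -> (mu F <= nu F)%E.
Proof.
move=> mF dF; have p2 : 0 < 2 ^+ N :> R by rewrite exprn_gt0.
pose J (z : int) : set R := `[z%:~R / 2 ^+ N, (z + 1)%:~R / 2 ^+ N[%classic.
have JE (z : int) x : J z x <-> Num.floor (2 ^+ N * x) = z.
  rewrite /J/= in_itv/= ler_pdivrMr// ltr_pdivlMr// ![_ * 2 ^+ N]mulrC.
  by split => [/floor_def//|<-]; exact: floor_itv.
(* The part of [F] over one cell, the integers being enumerated through [pickle]. The section at the
   left endpoint represents the whole cell because [F] is dyadic; indices that code no integer give
   the empty set. *)
pose Q k : set plane := if pickle_inv k is Some z then
  [set y | F (y, z%:~R / 2 ^+ N)] `*` J z else set0.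
have QE k z : pickle_inv k = Some z -> Q k = F `&` (setT `*` J z).
  move=> kz; rewrite /Q kz; apply/seteqP; split => -[y x] /=.
    move=> [Fy Jx]; split=> //; apply: dF Fy.
    by rewrite mulrC divfK ?gt_eqF// intrKfloor; apply/esym/JE.
  move=> [Fyx [_ Jx]]; split=> //; apply: dF Fyx.
  by rewrite [in RHS]mulrC divfK ?gt_eqF// intrKfloor; apply/JE.
have mJ z : measurable (J z) by exact: measurable_itv.
have mQ k : measurable (Q k).
  case e : (pickle_inv k : option int) => [z|]; last by rewrite /Q e.
  rewrite (QE _ _ e); apply: measurableI => //; apply: measurableX; first exact: measurableT.
  exact: mJ.
have FE : F = \bigcup_k Q k.
  apply/seteqP; split => [[y x] Fyx|[y x] [k _]].
    exists (pickle (Num.floor (2 ^+ N * x))); first exact: I.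
    by rewrite (QE _ _ (pickleK_inv _)); split; [exact: Fyx|split; [exact: I|exact/JE]].
  case e : (pickle_inv k : option int) => [z|]; last by rewrite /Q e.
  by rewrite (QE _ _ e) => -[].
have tQ : trivIset setT Q.
  apply/trivIsetP => i j _ _ ij; apply/seteqP; split => // -[y x] [].
  case ei : (pickle_inv i : option int) => [z|]; last by rewrite /Q ei.
  case ej : (pickle_inv j : option int) => [z'|]; last by rewrite /Q ej.
  rewrite (QE _ _ ei) (QE _ _ ej) => -[_ [_ /JE h]] [_ [_ /JE h']].
  have := @pickle_invK int i; have := @pickle_invK int j; rewrite ei ej /= -h -h' => ej' ei'.
  by move: ij; rewrite -ei' -ej' eqxx.
rewrite FE !measure_semi_bigcup//; [|exact: bigcup_measurable..].
apply: lee_nneseries => // k _.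
case e : (pickle_inv k : option int) => [z|]; last by rewrite /Q e !measure0.
rewrite /Q e; apply: mu_le.
  have := @measurable_ysection _ _ _ _ F (z%:~R / 2 ^+ N) mF.
  by rewrite (_ : ysection _ _ = [set y | F (y, z%:~R / 2 ^+ N)])// /ysection;
    apply/seteqP; split => y /=; rewrite inE.
by rewrite ler_pM2r ?invr_gt0// ler_int lerDl.
Qed.

(** The approximation is taken for the sum [mu + nu], so that a single dyadic set is close to [A]
    for both measures. *)
Lemma le_measure_rectangle (A : set plane) : measurable A -> (mu A <= nu A)%E.
Proof.
move=> mA; apply/lee_addgt0Pr => e e0.
have e2 : 0 < e / 2 by rewrite divr_gt0.
have sfin : (measure_add mu nu setT < +oo)%E by rewrite measure_addE lte_add_pinfty.
have [_ /(_ _ e2)[N [F [mF dF]]]] := measurable_approximable sfin mA.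
move=> h'; have h : (mu (symdiff A F) + nu (symdiff A F) < (e / 2)%:E)%E.
  by rewrite -measure_addE.
have mS := measurable_symdiff mA mF.
have h1 : (mu (symdiff A F) <= (e / 2)%:E)%E.
  by apply/ltW; apply: le_lt_trans h; rewrite leeDl.
have h2 : (nu (symdiff A F) <= (e / 2)%:E)%E.
  by apply/ltW; apply: le_lt_trans h; rewrite leeDr.
have tri (m : {measure set plane -> \bar R}) (C D : set plane) : measurable C -> measurable D ->
    symdiff C D = symdiff A F -> (m C <= m D + m (symdiff A F))%E.
  move=> mC mD CD; apply: le_trans (measureU2 _ mD mS); apply: le_measure; rewrite ?inE//.
    exact: measurableU.
  by move=> x Cx; rewrite -CD /symdiff/=; case: (pselect (D x)); tauto.
have symC : symdiff F A = symdiff A F by rewrite /symdiff setUC.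
apply: (le_trans (tri mu A F mA mF erefl)).
rewrite [e]splitr EFinD addeA; apply: leeD => //.
apply: (le_trans (dyadic_le_measure mF dF)).
by apply: (le_trans (tri nu F A mF mA symC)); rewrite leeD2l.
Qed.

End rectangle_domination.

(** * Moments from Laplace and Fourier transforms *)

Section difference_quotients.
Context {R : realType}.
Implicit Types (f g : R -> R) (u : nat -> R) (x y d : R).

Lemma cvg_diffquot f x d u : is_derive x 1 f d -> (forall n, u n != 0) ->
  u n @[n --> \oo] --> 0 -> (f (x + u n) - f x) / u n @[n --> \oo] --> d.
Proof.
move=> df u0 uc; have [g [gE gc gx]] := (is_derive1_caratheodory f x d).1 df.
rewrite (_ : (fun n => _) = (fun n => g (x + u n))); last first.
  by apply/funext => n; rewrite gE addrAC subrr add0r mulfK.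
rewrite -gx; apply: (continuous_cvg _ gc); rewrite -[X in _ --> X](addr0 x).
by apply: cvgD => //; exact: cvg_cst.
Qed.

Lemma norm_sin_le x : `|sin x| <= `|x|.
Proof.
wlog x0 : x / 0 <= x.
  move=> h; have [/h//|/ltW x0] := leP 0 x.
  by rewrite -normrN -sinN -[leRHS]normrN h// oppr_ge0.
have [] := @MVT_segment R sin cos 0 x x0.
  by apply: continuous_subspaceT => y; exact: continuous_sin.
move=> c _; rewrite sin0 !subr0 => ->.
by rewrite normrM ler_piMl// cos_max.
Qed.

Let n1_neq0 n : n.+1%:R^-1 != 0 :> R. Proof. by rewrite invr_eq0 pnatr_eq0. Qed.

Lemma cvg_sin_quot x : n.+1%:R * sin (n.+1%:R^-1 * x) @[n --> \oo] --> x.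
Proof.
have D : is_derive (0 : R) 1 (fun t => sin (t * x)) x.
  have D : is_derive (0 : R) 1 (fun t => sin (t * x)) (cos (0 * x) * x).
    apply: (@is_derive1_comp _ (fun y => sin y) (fun t => t * x)).
    by apply: is_derive_eq; rewrite /GRing.scale/= mulr1; ring.
  by move: D; rewrite mul0r cos0 mul1r.
have := cvg_diffquot D n1_neq0 (@cvg_harmonic R).
by under eq_fun do rewrite add0r mul0r sin0 subr0 invrK mulrC.
Qed.

Lemma cvg_expR_quot y : n.+1%:R * (1 - expR (- (n.+1%:R^-1 * y))) @[n --> \oo] --> y.
Proof.
have D : is_derive (0 : R) 1 (fun t => - expR (- (t * y))) y.
  have D : is_derive (0 : R) 1 (fun t => expR (- (t * y))) (expR (- (0 * y)) * - y).
    apply: (@is_derive1_comp _ (fun y => expR y) (fun t => - (t * y))).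
    by apply: is_derive_eq; rewrite /GRing.scale/= mulr1; ring.
  by apply: is_derive_eq; rewrite mul0r oppr0 expR0; ring.
have := cvg_diffquot D n1_neq0 (@cvg_harmonic R).
by under eq_fun do rewrite add0r mul0r oppr0 expR0 invrK mulrC opprK addrC.
Qed.

Lemma expR_quot_le n y : 0 <= y -> 0 <= n.+1%:R * (1 - expR (- (n.+1%:R^-1 * y))) <= y.
Proof.
move=> y0; have q0 : 0 <= n.+1%:R^-1 * y by rewrite mulr_ge0// invr_ge0.
rewrite mulr_ge0 ?subr_ge0 ?expR_le1 ?oppr_le0//= -ler_pdivlMl//.
by move: (n.+1%:R^-1 * y) => z; have := expR_ge1Dx (- z); lra.
Qed.

(** The half-angle form is a square, which yields at once the sign, the limit and the bound by
    [x ^+ 2] from those of the sine quotient. *)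
Lemma cos_quotE n x : n.+1%:R ^+ 2 * (2 - 2 * cos (n.+1%:R^-1 * x)) =
  (n.+1%:R * sin (n.+1%:R^-1 * (x / 2))) ^+ 2 * 4.
Proof.
have -> : n.+1%:R^-1 * x = (n.+1%:R^-1 * (x / 2)) *+ 2 by rewrite -mulr_natr; field.
by rewrite cos_mulr2n exprMn sin2cos2 -mulr_natr; ring.
Qed.

Lemma cvg_cos_quot x : n.+1%:R ^+ 2 * (2 - 2 * cos (n.+1%:R^-1 * x)) @[n --> \oo] --> x ^+ 2.
Proof.
under eq_fun do rewrite cos_quotE.
have -> : x ^+ 2 = (x / 2) * (x / 2) * 4 by field.
apply: cvgMl; under eq_fun do rewrite expr2.
by apply: cvgM; exact: cvg_sin_quot.
Qed.

Lemma sin_quot_le n x : `|n.+1%:R * sin (n.+1%:R^-1 * x)| <= `|x|.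
Proof.
rewrite normrM ger0_norm// -ler_pdivlMl// (le_trans (norm_sin_le _))//.
by rewrite normrM ger0_norm ?invr_ge0.
Qed.

Lemma cos_quot_le n x : 0 <= n.+1%:R ^+ 2 * (2 - 2 * cos (n.+1%:R^-1 * x)) <= x ^+ 2.
Proof.
rewrite cos_quotE mulr_ge0 ?sqr_ge0//=.
have -> : x ^+ 2 = `|x / 2| ^+ 2 * 4 by rewrite real_normK ?num_real//; field.
rewrite -[X in X * 4]real_normK ?num_real// ler_wpM2r// lerXn2r ?nnegrE//.
exact: sin_quot_le.
Qed.

Lemma cvg_second_difference g g' d x : (forall y, is_derive y 1 g (g' y)) ->
  is_derive x 1 g' d ->
  n.+1%:R ^+ 2 * (g (x + n.+1%:R^-1) + g (x - n.+1%:R^-1) - 2 * g x) @[n --> \oo] --> d.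
Proof.
move=> dg dg'.
have [w [wE wc wx]] := (is_derive1_caratheodory g' x d).1 dg'.
apply/cvgrPdist_le => e e0.
have /cvgrPdist_le/(_ (e / 2)) := wc; rewrite divr_gt0// => /(_ isT) => /nbhs_ballP[r /= r0 hr].
have hw s : 0 < s < r -> `|w (x + s) - d| <= e / 2 /\ `|w (x - s) - d| <= e / 2.
  move=> /andP[s0 sr]; rewrite -wx; split; rewrite distrC; apply: hr.
    by rewrite /ball/= opprD addrA subrr add0r normrN gtr0_norm.
  by rewrite /ball/= opprB addrC subrK gtr0_norm.
near=> n.
have n0 : 0 < n.+1%:R^-1 :> R by rewrite invr_gt0.
have nr : n.+1%:R^-1 < r by near: n; exact: (near_infty_natSinv_lt (PosNum r0)).
set h := n.+1%:R^-1 in n0 nr *.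
have -> : n.+1%:R = h^-1 :> R by rewrite invrK.
(* The mean value theorem reduces the second difference to [g' (x + xi) - g' (x - xi)], which the
   slope function [w] of [g'] at [x] controls: no continuity of a second derivative is involved. *)
pose F s := g (x + s) + g (x - s) - 2 * g x - d * s ^+ 2.
have dF (s : R) : is_derive s 1 F (g' (x + s) - g' (x - s) - 2 * d * s).
  have D1 : is_derive s 1 (fun s => g (x + s)) (g' (x + s)).
    rewrite -[X in is_derive _ _ _ X]mulr1.
    apply: (@is_derive1_comp _ g (fun s => x + s)); first exact: dg.
    by have := is_deriveD (is_derive_cst x s 1) (is_derive_id s 1); rewrite add0r.
  have D2 : is_derive s 1 (fun s => g (x - s)) (- g' (x - s)).
    rewrite -mulrN1.
    apply: (@is_derive1_comp _ g (fun s => x - s)); first exact: dg.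
    by have := is_deriveB (is_derive_cst x s 1) (is_derive_id s 1); rewrite sub0r.
  by apply: is_derive_eq; rewrite /GRing.scale/= mulr1; ring.
have [] := @MVT R F (fun s => g' (x + s) - g' (x - s) - 2 * d * s) 0 h n0.
  apply: continuous_subspaceT => s.
  by apply/differentiable_continuous/derivable1_diffP; have [] := dF s.
move=> xi; rewrite in_itv/= => /andP[xi0 xih].
have -> : F 0 = 0 by rewrite /F addr0 subr0; ring.
have xir : 0 < xi < r by rewrite xi0 (lt_trans xih).
have [w1 w2] := hw xi xir.
have -> : g' (x + xi) - g' (x - xi) - 2 * d * xi = xi * ((w (x + xi) - d) + (w (x - xi) - d)).
  have := wE (x + xi); have := wE (x - xi).
  rewrite [x + xi - x]addrAC subrr add0r [x - xi - x]addrAC subrr add0r => h1 h2.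
  have -> : g' (x + xi) = g' x + w (x + xi) * xi by rewrite -h2; ring.
  have -> : g' (x - xi) = g' x + w (x - xi) * - xi by rewrite -h1; ring.
  by ring.
rewrite !subr0 => FE.
have -> : d - h^-1 ^+ 2 * (g (x + h) + g (x - h) - 2 * g x) = - (F h / h ^+ 2).
  by rewrite /F; field; rewrite gt_eqF.
rewrite normrN FE expr2 invfM mulrA mulfK ?gt_eqF// normrM normfV (gtr0_norm n0).
rewrite ler_pdivrMr// normrM (gtr0_norm xi0) [e * h]mulrC ler_pM ?(ltW xi0)//.
  exact: ltW.
by rewrite (le_trans (ler_normD _ _))// [e]splitr lerD.
Unshelve. all: by end_near. Qed.

End difference_quotients.

Section moments_from_transforms.
Context {d} {T : measurableType d} {R : realType} {mu : {measure set T -> \bar R}}.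
Local Notation intg f := (mu.-integrable setT (EFin \o f)).
Implicit Types h k X Y : T -> R.

Lemma intg_bounded_mul h k (C : R) : measurable_fun setT k ->
  (forall x, `|k x| <= C) -> intg h -> intg (fun x => h x * k x).
Proof.
move=> mk kC ih; apply: (@le_intg _ _ _ _ _ (fun x => `|h x| * C)).
- by apply: measurable_funM => //; exact: intg_measurable ih.
- by move=> x; rewrite normrM ler_wpM2l.
- rewrite (_ : EFin \o _ = (fun x => (`|h x|%:E * C%:E)%E)); last by apply/funext.
  by apply: (integrableZr measurableT); exact: integrable_norm.
Qed.

Lemma measurable_expR_scale l Y : measurable_fun setT Y ->
  measurable_fun setT (fun x => expR (- (l * Y x))).
Proof.
move=> mY; apply: measurableT_comp => //; apply: measurableT_comp => //.
exact: measurable_funM.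
Qed.

Lemma expR_scale_le1 (l y : R) : 0 <= l -> 0 <= y -> `|expR (- (l * y))| <= 1.
Proof. by move=> l0 y0; rewrite ger0_norm ?expR_ge0// expR_le1 oppr_le0 mulr_ge0. Qed.

Lemma measurable_cos_scale s X : measurable_fun setT X ->
  measurable_fun setT (fun x => cos (s * X x)).
Proof.
move=> mX; apply: measurableT_comp; last exact: measurable_funM.
by apply: continuous_measurable_fun; exact: continuous_cos.
Qed.

Lemma measurable_sin_scale s X : measurable_fun setT X ->
  measurable_fun setT (fun x => sin (s * X x)).
Proof.
move=> mX; apply: measurableT_comp; last exact: measurable_funM.
by apply: continuous_measurable_fun; exact: continuous_sin.
Qed.

Lemma intg_expR l h Y : measurable_fun setT Y -> (forall x, 0 <= Y x) -> 0 <= l ->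
  intg h -> intg (fun x => h x * expR (- (l * Y x))).
Proof.
move=> mY Y0 l0; apply: (@intg_bounded_mul _ _ 1); first exact: measurable_expR_scale.
by move=> x; exact: expR_scale_le1.
Qed.

Lemma intg_cos s h X : measurable_fun setT X -> intg h -> intg (fun x => h x * cos (s * X x)).
Proof.
move=> mX; apply: (@intg_bounded_mul _ _ 1); first exact: measurable_cos_scale.
by move=> x; exact: cos_max.
Qed.

Lemma intg_sin s h X : measurable_fun setT X -> intg h -> intg (fun x => h x * sin (s * X x)).
Proof.
move=> mX; apply: (@intg_bounded_mul _ _ 1); first exact: measurable_sin_scale.
by move=> x; exact: sin_max.
Qed.

Section laplace.
Variables h Y : T -> R.
Hypotheses (mY : measurable_fun setT Y) (Y_ge0 : forall x, 0 <= Y x) (ih : intg h).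

Let quot n x := h x * (n.+1%:R * (1 - expR (- (n.+1%:R^-1 * Y x)))).

Let integral_quot n : intg (quot n) /\ \int[mu]_x quot n x =
  n.+1%:R * (\int[mu]_x h x - \int[mu]_x (h x * expR (- (n.+1%:R^-1 * Y x)))).
Proof.
have i1 : intg (fun x => h x * expR (- (n.+1%:R^-1 * Y x))).
  by apply: intg_expR => //; rewrite invr_ge0.
have E x : quot n x = n.+1%:R * (h x - h x * expR (- (n.+1%:R^-1 * Y x))).
  by rewrite /quot; ring.
have i2 : intg (fun x => h x - h x * expR (- (n.+1%:R^-1 * Y x))).
  exact: (integrableB measurableT ih i1).
split.
  rewrite (_ : EFin \o _ =
    (fun x => n.+1%:R%:E * (h x - h x * expR (- (n.+1%:R^-1 * Y x)))%:E)%E).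
    exact: (integrableZl measurableT _ i2).
  by apply/funext => x /=; rewrite E.
by under eq_Rintegral do rewrite E; rewrite RintegralZl// RintegralB.
Qed.

(** Convergence of the difference quotients of the transform already forces integrability, since
    they integrate functions between 0 and [h * Y]. *)
Lemma laplace_moment c : (forall x, 0 <= h x) ->
  n.+1%:R * (\int[mu]_x h x - \int[mu]_x (h x * expR (- (n.+1%:R^-1 * Y x)))) @[n --> \oo] --> c ->
  intg (fun x => h x * Y x) /\ \int[mu]_x (h x * Y x) = c.
Proof.
move=> h0 hc; apply: (@increasing_approx_cvg _ _ _ _ quot).
- by move=> n; exact: intg_measurable (integral_quot n).1.
- by move=> x; apply: cvgMr; exact: cvg_expR_quot.
- move=> n x; have /andP[q0 q1] := expR_quot_le n (Y_ge0 x).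
  by rewrite mulr_ge0//= ler_wpM2l.
- by move=> n; exact: (integral_quot n).1.
- rewrite (_ : (fun n => _) = (fun n => n.+1%:R * (\int[mu]_x h x -
    \int[mu]_x (h x * expR (- (n.+1%:R^-1 * Y x))))))//.
  by apply/funext => n; exact: (integral_quot n).2.
Qed.

(** Once integrability is known [h] may change sign: dominated convergence replaces Fatou. *)
Lemma laplace_moment_cvg : intg (fun x => h x * Y x) ->
  n.+1%:R * (\int[mu]_x h x - \int[mu]_x (h x * expR (- (n.+1%:R^-1 * Y x)))) @[n --> \oo] -->
  \int[mu]_x (h x * Y x).
Proof.
move=> ihY; rewrite (_ : (fun n => _) = (fun n => \int[mu]_x quot n x)); last first.
  by apply/funext => n; rewrite (integral_quot n).2.
have [] // := @Rdominated_cvg _ _ _ mu quot (fun x => h x * Y x) (fun x => `|h x * Y x|).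
- by move=> n; exact: intg_measurable (integral_quot n).1.
- by move=> x; apply: cvgMr; exact: cvg_expR_quot.
- move=> n x; have /andP[q0 q1] := expR_quot_le n (Y_ge0 x).
  by rewrite [leLHS]normrM [leRHS]normrM ler_wpM2l// ger0_norm// (le_trans q1)// ler_norm.
- exact: integrable_norm.
Qed.

End laplace.

Section fourier.
Variables h X : T -> R.
Hypotheses (mX : measurable_fun setT X) (ih : intg h).

Let quot n x := h x * (n.+1%:R ^+ 2 * (2 - 2 * cos (n.+1%:R^-1 * X x))).

Let integral_quot n : intg (quot n) /\ \int[mu]_x quot n x =
  n.+1%:R ^+ 2 * (2 * \int[mu]_x h x - 2 * \int[mu]_x (h x * cos (n.+1%:R^-1 * X x))).
Proof.
have i1 := intg_cos n.+1%:R^-1 mX ih.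
have E x : quot n x = 2 * n.+1%:R ^+ 2 * (h x - h x * cos (n.+1%:R^-1 * X x)).
  by rewrite /quot; ring.
have i2 : intg (fun x => h x - h x * cos (n.+1%:R^-1 * X x)).
  exact: (integrableB measurableT ih i1).
split.
  rewrite (_ : EFin \o _ =
    (fun x => (2 * n.+1%:R ^+ 2)%:E * (h x - h x * cos (n.+1%:R^-1 * X x))%:E)%E).
    exact: (integrableZl measurableT _ i2).
  by apply/funext => x /=; rewrite E.
by under eq_Rintegral do rewrite E; rewrite RintegralZl// RintegralB//; ring.
Qed.

Lemma cos_moment c : (forall x, 0 <= h x) ->
  n.+1%:R ^+ 2 * (2 * \int[mu]_x h x - 2 * \int[mu]_x (h x * cos (n.+1%:R^-1 * X x)))
    @[n --> \oo] --> c ->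
  intg (fun x => h x * X x ^+ 2) /\ \int[mu]_x (h x * X x ^+ 2) = c.
Proof.
move=> h0 hc; apply: (@increasing_approx_cvg _ _ _ _ quot).
- by move=> n; exact: intg_measurable (integral_quot n).1.
- by move=> x; apply: cvgMr; exact: cvg_cos_quot.
- move=> n x; have /andP[q0 q1] := cos_quot_le n (X x).
  by rewrite mulr_ge0//= ler_wpM2l.
- by move=> n; exact: (integral_quot n).1.
- rewrite (_ : (fun n => _) = (fun n => n.+1%:R ^+ 2 * (2 * \int[mu]_x h x -
    2 * \int[mu]_x (h x * cos (n.+1%:R^-1 * X x)))))//.
  by apply/funext => n; exact: (integral_quot n).2.
Qed.

Lemma cos_moment_cvg : intg (fun x => h x * X x ^+ 2) ->
  n.+1%:R ^+ 2 * (2 * \int[mu]_x h x - 2 * \int[mu]_x (h x * cos (n.+1%:R^-1 * X x)))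
    @[n --> \oo] --> \int[mu]_x (h x * X x ^+ 2).
Proof.
move=> ihX; rewrite (_ : (fun n => _) = (fun n => \int[mu]_x quot n x)); last first.
  by apply/funext => n; rewrite (integral_quot n).2.
have [] // := @Rdominated_cvg _ _ _ mu quot (fun x => h x * X x ^+ 2) (fun x => `|h x * X x ^+ 2|).
- by move=> n; exact: intg_measurable (integral_quot n).1.
- by move=> x; apply: cvgMr; exact: cvg_cos_quot.
- move=> n x; have /andP[q0 q1] := cos_quot_le n (X x).
  by rewrite [leLHS]normrM [leRHS]normrM ler_wpM2l// ger0_norm// (le_trans q1)// ler_norm.
- exact: integrable_norm.
Qed.

Lemma sin_moment_cvg : intg (fun x => h x * X x) ->
  n.+1%:R * \int[mu]_x (h x * sin (n.+1%:R^-1 * X x)) @[n --> \oo] -->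
  \int[mu]_x (h x * X x).
Proof.
move=> ihX; pose qs n x := h x * (n.+1%:R * sin (n.+1%:R^-1 * X x)).
have E n x : qs n x = n.+1%:R * (h x * sin (n.+1%:R^-1 * X x)) by rewrite /qs; ring.
have i1 n := intg_sin n.+1%:R^-1 mX ih.
rewrite (_ : (fun n => _) = (fun n => \int[mu]_x qs n x)); last first.
  by apply/funext => n; under [RHS]eq_Rintegral do rewrite E; rewrite RintegralZl//; exact: i1.
have [] // := @Rdominated_cvg _ _ _ mu qs (fun x => h x * X x) (fun x => `|h x * X x|).
- move=> n; apply: measurable_funM; first exact: intg_measurable ih.
  by apply: measurable_funM => //; exact: measurable_sin_scale.
- by move=> x; apply: cvgMr; exact: cvg_sin_quot.
- by move=> n x; rewrite !normrM ler_wpM2l// -normrM sin_quot_le.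
- exact: integrable_norm.
Qed.

End fourier.

(* The second differences of the characteristic function control the next even moment
   (Fatou), whose characteristic function is then minus the second derivative. *)
Lemma smooth_char_moments X g : measurable_fun setT X -> (mu setT < +oo)%E -> smooth_class g ->
  (forall s, \int[mu]_x cos (s * X x) = g s) -> forall n, intg (fun x => X x ^+ (2 * n)).
Proof.
move=> mX mufin sg gE n.
suff : intg (fun x => X x ^+ (2 * n)) /\ exists g, smooth_class g /\
    forall s, \int[mu]_x (X x ^+ (2 * n) * cos (s * X x)) = g s by case.
elim: n => [|n [ih [{}g [{}sg {}gE]]]].
  split; last first.
    exists g; split => // s; rewrite -gE.
    by apply: eq_Rintegral => x _; rewrite muln0 expr0 mul1r.
  rewrite (_ : EFin \o _ = EFin \o cst 1).
    apply: measurable_bounded_integrable => //; exists 1; split; first exact: num_real.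
    by move=> y y1 x _ /=; rewrite normr1 ltW.
  by apply/funext => x /=; rewrite muln0 expr0.
have [g' [sg' dg]] := smooth_class_derive sg.
have [g'' [sg'' dg']] := smooth_class_derive sg'.
have gint : \int[mu]_x X x ^+ (2 * n) = g 0.
  by rewrite -gE; apply: eq_Rintegral => x _; rewrite mul0r cos0 mulr1.
have geven s : g (- s) = g s.
  by rewrite -!gE; apply: eq_Rintegral => x _; rewrite mulNr cosN.
have XE x : X x ^+ (2 * n.+1) = X x ^+ (2 * n) * X x ^+ 2 by rewrite mulnS addnC exprD.
have ihX : intg (fun x => X x ^+ (2 * n) * X x ^+ 2).
  have [] // := @cos_moment (fun x => X x ^+ (2 * n)) X mX ih (- g'' 0).
    by move=> x; rewrite exprM exprn_ge0// sqr_ge0.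
  rewrite (_ : (fun m => _) = (fun m => - (m.+1%:R ^+ 2 *
      (g (0 + m.+1%:R^-1) + g (0 - m.+1%:R^-1) - 2 * g 0)))).
    by apply: cvgN; exact: cvg_second_difference dg (dg' 0).
  by apply/funext => m /=; rewrite gE gint sub0r geven add0r; ring.
split.
  by rewrite (_ : EFin \o _ = EFin \o (fun x => X x ^+ (2 * n) * X x ^+ 2))//;
    apply/funext => x /=; rewrite XE.
exists (fun s => -1 * g'' s); split; first by apply: smooth_mul => //; exact: smooth_cst.
(* The weight now contains [cos (s * X x)] and changes sign, so Fatou is out of reach; the
   integrability just obtained at [s = 0] provides the domination. *)
move=> s; have ihs := intg_cos s mX ih.
have ihsX : intg (fun x => (X x ^+ (2 * n) * cos (s * X x)) * X x ^+ 2).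
  rewrite (_ : EFin \o _ = EFin \o (fun x => (X x ^+ (2 * n) * X x ^+ 2) * cos (s * X x))).
    exact: intg_cos.
  by apply/funext => x /=; rewrite mulrAC.
have cv := cos_moment_cvg mX ihs ihsX.
rewrite (_ : \int[mu]_x _ =
  \int[mu]_x (X x ^+ (2 * n) * cos (s * X x) * X x ^+ 2)); last first.
  by apply: eq_Rintegral => x _; rewrite XE mulrAC.
apply: (cvg_unique _ cv); first exact: norm_hausdorff.
rewrite (_ : (fun m => _) = (fun m => - (m.+1%:R ^+ 2 *
    (g (s + m.+1%:R^-1) + g (s - m.+1%:R^-1) - 2 * g s)))).
  by rewrite mulN1r; apply: cvgN; exact: cvg_second_difference dg (dg' s).
apply/funext => m /=; rewrite -!gE; set t := m.+1%:R^-1.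
(* The sum formula for cosines turns the second difference at [s] into a cosine quotient with weight
   [X x ^+ (2 * n) * cos (s * X x)]. *)
have -> : \int[mu]_x (X x ^+ (2 * n) * cos ((s + t) * X x)) +
    \int[mu]_x (X x ^+ (2 * n) * cos ((s - t) * X x)) =
    2 * \int[mu]_x (X x ^+ (2 * n) * cos (s * X x) * cos (t * X x)).
  rewrite -RintegralD//; [|exact: intg_cos..].
  rewrite -RintegralZl//; last exact: intg_cos.
  by apply: eq_Rintegral => x _; rewrite mulrDl mulrBl cosD cosB; ring.
by ring.
Qed.

End moments_from_transforms.

(** * Absolute continuity *)

Section poisson_kernel.
Context {R : realType}.
Local Notation leb := (@lebesgue_measure R).

(* The summand [1] makes the integrand nonnegative, so that Tonelli applies. *)
Lemma integral_poisson_kernel (h z : R) : 0 < h ->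
  (\int[leb]_(s in `[0%R, +oo[) (expR (- (h * s)) * (1 + cos (s * z)))%:E =
   (h^-1 + h / (h ^+ 2 + z ^+ 2))%:E)%E.
Proof.
move=> h0; have hz : 0 < h ^+ 2 + z ^+ 2 by rewrite ltr_wpDr ?sqr_ge0// exprn_gt0.
pose G s := - h^-1 + (z * sin (s * z) - h * cos (s * z)) / (h ^+ 2 + z ^+ 2).
pose F s := expR (- (h * s)) * G s.
have dE (s : R) : is_derive s 1 (fun s => expR (- (h * s))) (expR (- (h * s)) * - h).
  apply: (@is_derive1_comp _ expR (fun s => - (h * s))).
  by apply: is_derive_eq; rewrite /GRing.scale/= mulr1.
have dlin (s : R) : is_derive s 1 (fun s : R => s * z) z.
  by apply: is_derive_eq; rewrite /GRing.scale/= mulr1; ring.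
have dG (s : R) : is_derive s 1 G ((z * (cos (s * z) * z) + h * (sin (s * z) * z)) / (h ^+ 2 + z ^+ 2)).
  have D1 := @is_derive1_comp _ (fun y => sin y) (fun s => s * z) s _ _ (is_derive_sin _) (dlin s).
  have D2 := @is_derive1_comp _ (fun y => cos y) (fun s => s * z) s _ _ (is_derive_cos _) (dlin s).
  have -> : G = (fun s => - h^-1 + (h ^+ 2 + z ^+ 2)^-1 * (z * ((fun y => sin y) \o (fun s => s * z)) s
      - h * ((fun y => cos y) \o (fun s => s * z)) s)).
    by apply/funext => t; rewrite /G/= [_^-1 * _]mulrC.
  by apply: is_derive_eq; rewrite /GRing.scale/=; field; rewrite gt_eqF.
have dF (s : R) : is_derive s 1 F (expR (- (h * s)) * (1 + cos (s * z))).
  have D1 := dE s; have D2 := dG s.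
  apply: is_derive_eq; rewrite /GRing.scale/= /G; field.
  by rewrite !gt_eqF.
have cF s : {for s, continuous F}.
  by apply/differentiable_continuous/derivable1_diffP; have [] := dF s.
have ce (s : R) : {for s, continuous (fun s : R => expR (- (h * s)))}.
  by apply/differentiable_continuous/derivable1_diffP; have [] := dE s.
have cc (s : R) : {for s, continuous (fun s : R => cos (s * z))}.
  have D2 := @is_derive1_comp _ (fun y => cos y) (fun s => s * z) s _ _ (is_derive_cos _) (dlin s).
  by apply/differentiable_continuous/derivable1_diffP; have [] := D2.
have cI (s : R) : {for s, continuous (fun s : R => expR (- (h * s)) * (1 + cos (s * z)))}.
  apply: cvgM; first exact: ce.
  by apply: cvgD; [exact: cvg_cst|exact: cc].
rewrite (@ge0_continuous_FTC2y _ _ F 0 0).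
- by rewrite -EFinB; congr EFin; rewrite /F /G !mulr0 !mul0r oppr0 expR0 sin0 cos0;
    field; rewrite !gt_eqF.
- by move=> s _; rewrite mulr_ge0 ?expR_ge0// -lerBlDl sub0r cos_geN1.
- by apply: continuous_subspaceT => s; exact: cI.
- pose C := h^-1 + (`|z| + h) / (h ^+ 2 + z ^+ 2).
  have Gle s : `|G s| <= C.
    rewrite (le_trans (ler_normD _ _))// normrN; apply: lerD.
      by rewrite ger0_norm ?invr_ge0 ?(ltW h0).
    rewrite normrM normfV (gtr0_norm hz) ler_wpM2r ?invr_ge0 ?(ltW hz)//.
    rewrite (le_trans (ler_normB _ _))// !normrM (gtr0_norm h0) lerD//.
      by rewrite ler_piMr// sin_max.
    by rewrite ler_piMr ?(ltW h0)// cos_max.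
  have e0 : expR (- (h * s)) * C @[s --> +oo] --> 0.
    rewrite -[X in _ --> X](mul0r C); apply: cvgMl.
    apply: (cvg_comp _ _ _ (@cvgr_expR R)).
    by apply: gt0_cvgMry => //; exact: cvg_id.
  apply/norm_cvg0P; apply: (@squeeze_cvgr _ _ _ _ (cst 0) (fun s => expR (- (h * s)) * C)) => //.
    by apply: nearW => s; rewrite normr_ge0/= normrM (ger0_norm (expR_ge0 _)) ler_wpM2l ?expR_ge0.
  exact: cvg_cst.
- by move=> s _; have [] := dF s.
- by apply: cvg_at_right_filter; exact: cF.
- by move=> s _; rewrite derive1E; have [_ ->] := dF s.
Qed.

Lemma integral_expRy (h : R) : 0 < h ->
  (\int[leb]_(s in `[0%R, +oo[) (expR (- (h * s)))%:E = h^-1%:E)%E.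
Proof.
(* At [z = 0] the Poisson integrand is [2 * expR (- (h * s))]. *)
move=> h0; transitivity
  (\int[leb]_(s in `[0%R, +oo[) ((2^-1)%:E * (expR (- (h * s)) * (1 + cos (s * 0)))%:E))%E.
  by apply: eq_integral => s _; rewrite -EFinM mulr0 cos0; congr EFin; field.
rewrite ge0_integralZl//.
- by rewrite integral_poisson_kernel// -EFinM; congr EFin; rewrite expr0n addr0; field; rewrite gt_eqF.
- apply/measurable_EFinP; apply: measurable_funTS; apply: measurable_funM.
    by apply: (@measurable_expR_scale _ (measurableTypeR R)).
  apply: measurable_funD => //; apply: measurableT_comp.
    by apply: continuous_measurable_fun; exact: continuous_cos.
  exact: mulrr_measurable.
Qed.

Lemma cauchy_kernel_ge0 (h z : R) : 0 < h -> 0 <= h / (h ^+ 2 + z ^+ 2).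
Proof. by move=> h0; rewrite divr_ge0 ?(ltW h0)// addr_ge0 ?sqr_ge0. Qed.

Lemma measurable_cauchy_kernel d (T : measurableType d) (h : R) (Z : T -> R) : 0 < h ->
  measurable_fun setT Z -> measurable_fun setT (fun w => h / (h ^+ 2 + Z w ^+ 2)).
Proof.
move=> h0 mZ; rewrite (_ : (fun w => _) = (fun z => h / (h ^+ 2 + z ^+ 2)) \o Z)//.
apply: measurableT_comp => //; apply: continuous_measurable_fun => z.
apply: cvgM; first exact: cvg_cst.
apply: cvgV; first by rewrite gt_eqF// ltr_wpDr ?sqr_ge0// exprn_gt0.
by apply: cvgD; [exact: cvg_cst|exact: exprn_continuous].
Qed.

End poisson_kernel.

Section decay.
Context {R : realType}.
Variables (a b theta : R).
Hypotheses (a_gt0 : 0 < a) (b_gt0 : 0 < b) (theta_gt0 : 0 < theta).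

Lemma onePX_le (q : R) n : 0 <= q -> (1 + q) ^+ n <= 2 ^+ n * (1 + q ^+ n).
Proof.
move=> q0; have [q1|q1] := leP q 1.
  rewrite (@le_trans _ _ (2 ^+ n))//.
    by rewrite lerXn2r ?nnegrE//; lra.
  by rewrite ler_peMr ?exprn_ge0// lerDl exprn_ge0.
rewrite (@le_trans _ _ (2 ^+ n * q ^+ n))//.
  by rewrite -exprMn lerXn2r ?nnegrE//; lra.
by rewrite ler_wpM2l ?exprn_ge0// lerDr.
Qed.

(** However small [a] is, some [n] satisfies [1 <= n * (2 * a)]; one monomial of degree [n] in
    [dser] then beats [(1 + q) ^+ n], and the power [- (2 * a)] leaves at least one factor
    [(1 + q)^-1], which is integrable in [s] with [q = s ^+ 2]. *)
Lemma dser_powR_le : exists C : R, 0 <= C /\ forall s : R,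
  dser b theta (s ^+ 2) `^ (- (2 * a)) <= C * (oneDsqr s)^-1.
Proof.
have a2 : 0 < 2 * a by rewrite mulr_gt0.
pose n := (Num.truncn (2 * a)^-1).+1.
have na : 1 <= n%:R * (2 * a).
  rewrite -ler_pdivrMr// mul1r /n; exact/ltW/truncnS_gt.
pose d := dcoef b theta n; have d0 : 0 < d by exact: dcoef_gt0.
pose c := Num.min 1 d / 2 ^+ n.
have c0 : 0 < c by rewrite divr_gt0 ?exprn_gt0// lt_min ltr01.
exists (c `^ (- (2 * a))); split; first exact: powR_ge0.
move=> s; have q0 := sqr_ge0 s; set q := s ^+ 2 in q0 *.
have q1 : 0 < 1 + q by rewrite ltr_wpDr.
have cD : c * (1 + q) ^+ n <= dser b theta q.
  apply: le_trans (dser_ge b_gt0 theta_gt0 (Num.truncn (2 * a)^-1) q0).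
  apply: (@le_trans _ _ (Num.min 1 d * (1 + q ^+ n))).
    rewrite /c -mulrA ler_wpM2l ?le_min ?ler01 ?(ltW d0)//.
    by rewrite ler_pdivrMl ?exprn_gt0// onePX_le.
  rewrite mulrDr mulr1 lerD ?ge_min ?lexx// ler_wpM2r ?(exprn_ge0 _ q0)//.
  by rewrite ge_min lexx orbT.
rewrite (_ : oneDsqr s = 1 + q)// !powRN -invfM lef_pV2 ?posrE; last 2 first.
- by rewrite powR_gt0// (lt_le_trans _ cD)// mulr_gt0// exprn_gt0.
- by rewrite mulr_gt0// powR_gt0.
apply: (@le_trans _ _ ((c * (1 + q) ^+ n) `^ (2 * a))); last first.
  by rewrite ge0_ler_powR ?nnegrE ?(ltW a2)// ?(le_trans _ cD)// mulr_ge0 ?exprn_ge0// ltW.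
rewrite (powRM _ (ltW c0) (exprn_ge0 n (ltW q1))) ler_wpM2l ?powR_ge0//.
rewrite -powR_mulrn ?(ltW q1)// -powRrM.
by rewrite -[leLHS]powRr1 ?(ltW q1)// ler_powR// lerDl.
Qed.

End decay.

Section absolutely_continuous_law.
Context {R : realType} {d} {T : measurableType d} (P : probability T R).
Local Notation leb := (@lebesgue_measure R).
Variables (a b m theta : R).
Hypotheses (a_gt0 : 0 < a) (b_gt0 : 0 < b) (theta_gt0 : 0 < theta).
Variables (Y X : T -> R).
Hypotheses (mY : measurable_fun setT Y) (mX : measurable_fun setT X).
Hypothesis (Y_ge0 : forall w, 0 <= Y w).
Let Xc w := X w - m / theta.
Let D s := dser b theta (s ^+ 2).
Let E s := eser b theta (s ^+ 2).
Hypothesis cos_transform : forall l s, 0 <= l ->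
  \int[P]_w (cos (s * Xc w) * expR (- (l * Y w))) = ((E s + l * D s / 2) / b) `^ (- (2 * a)).
Hypothesis sin_transform : forall l s, 0 <= l ->
  \int[P]_w (sin (s * Xc w) * expR (- (l * Y w))) = 0.

Let mXc : measurable_fun setT Xc. Proof. exact: measurable_funB. Qed.

Let intg1 : P.-integrable setT (EFin \o cst 1).
Proof. exact: finite_measure_integrable_cst. Qed.

Let icos s : P.-integrable setT (EFin \o (fun w => cos (s * Xc w))).
Proof.
have := intg_cos s mXc intg1; rewrite (_ : EFin \o _ = EFin \o (fun w => cos (s * Xc w)))//.
by apply/funext => w /=; rewrite mul1r.
Qed.

Let isin s : P.-integrable setT (EFin \o (fun w => sin (s * Xc w))).
Proof.
have := intg_sin s mXc intg1; rewrite (_ : EFin \o _ = EFin \o (fun w => sin (s * Xc w)))//.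
by apply/funext => w /=; rewrite mul1r.
Qed.

Lemma laplace_Y l : 0 <= l ->
  \int[P]_w expR (- (l * Y w)) = (1 + l / (2 * b)) `^ (- (2 * a)).
Proof.
move=> l0; rewrite (_ : 1 + _ = (E 0 + l * D 0 / 2) / b).
  rewrite -(cos_transform _ l0).
  by apply: eq_Rintegral => w _; rewrite mul0r cos0 mul1r.
rewrite /E /D expr0n/= eser0 dser0; field.
by rewrite gt_eqF.
Qed.

Let mpre B : measurable B -> measurable (Y @^-1` B).
Proof. by move=> mB; rewrite -[X in measurable X]setTI; exact: mY. Qed.

(* Conditionally on [Y = y] the characteristic function of [Xc] at [s] is
   [D s `^ (- 2 a) * expR (- 2 * (E s / D s - b) * y)]. *)
Lemma conditional_char s B : measurable B ->
  (\int[P]_(w in Y @^-1` B) (cos (s * Xc w))%:E =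
   \int[P]_(w in Y @^-1` B) (D s `^ (- (2 * a)) * expR (- (2 * (E s / D s - b) * Y w)))%:E)%E.
Proof.
have Ds : 0 < D s by apply: dser_gt0 => //; exact: sqr_ge0.
have rho : 0 <= 2 * (E s / D s - b).
  rewrite mulr_ge0// subr_ge0 ler_pdivlMr//; apply: eser_ge => //; exact: sqr_ge0.
have ie l : 0 <= l -> P.-integrable setT (EFin \o (fun w => expR (- (l * Y w)))).
  move=> l0; have := intg_expR mY Y_ge0 l0 intg1.
  rewrite (_ : EFin \o _ = EFin \o (fun w => expR (- (l * Y w))))//.
  by apply/funext => w /=; rewrite mul1r.
have ih2 : P.-integrable setT (EFin \o
    (fun w => D s `^ (- (2 * a)) * expR (- (2 * (E s / D s - b) * Y w)))).
  exact: (integrableZl measurableT _ (ie _ rho)).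
apply: laplace_unique => // l l0; rewrite cos_transform//.
(* Factoring [D s] out of [(E s + l * D s / 2) / b] leaves
   [1 + (2 * (E s / D s - b) + l) / (2 * b)]: the Laplace transform of [Y] at a shifted argument. *)
transitivity (\int[P]_w (D s `^ (- (2 * a)) * expR (- ((2 * (E s / D s - b) + l) * Y w)))).
  rewrite RintegralZl//; last by apply: ie; rewrite addr_ge0.
  rewrite laplace_Y ?addr_ge0// -powRM ?(ltW Ds)//; last first.
    by rewrite addr_ge0// divr_ge0 ?addr_ge0// mulr_ge0// ltW.
  by congr (_ `^ _); field; rewrite !gt_eqF.
by apply: eq_Rintegral => w _; rewrite -mulrA -expRD; congr (_ * expR _); ring.
Qed.

Let C := sval (cid (dser_powR_le a_gt0 b_gt0 theta_gt0)).
Let C_ge0 : 0 <= C. Proof. by rewrite /C; case: cid => ? []. Qed.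
Let D_le s : D s `^ (- (2 * a)) <= C * (oneDsqr s)^-1.
Proof. by rewrite /C; case: cid => C' [C0 h]; exact: h. Qed.

(** The lower bound matters too: it allows a factor [cos (s * x0)] to be replaced by 1 when the
    cosine is recentred at an arbitrary point. *)
Lemma conditional_char_bound s B : measurable B ->
  (0 <= \int[P]_(w in Y @^-1` B) (cos (s * Xc w))%:E <= (C * (oneDsqr s)^-1)%:E * P (Y @^-1` B))%E.
Proof.
move=> mB; rewrite conditional_char//.
have e0 w : 0 <= D s `^ (- (2 * a)) * expR (- (2 * (E s / D s - b) * Y w)).
  by rewrite mulr_ge0 ?powR_ge0 ?expR_ge0.
rewrite integral_ge0/=; last by move=> w _; rewrite lee_fin.
rewrite -integral_cst; last exact: mpre.
apply: ge0_le_integral => //.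
- exact: mpre.
- by move=> w _; rewrite lee_fin.
- apply/measurable_EFinP; apply: measurable_funTS; apply: measurable_funM => //.
  exact: measurable_expR_scale.
- move=> w _; rewrite lee_fin; apply: le_trans (D_le s).
  rewrite ler_piMr ?powR_ge0// expR_le1 oppr_le0 !mulr_ge0// subr_ge0 ler_pdivlMr.
    by apply: eser_ge => //; exact: sqr_ge0.
  by apply: dser_gt0 => //; exact: sqr_ge0.
Qed.

(** Laplace uniqueness against the zero weight: given [Y], the centred [X] is symmetric. *)
Lemma conditional_sin s B : measurable B ->
  (\int[P]_(w in Y @^-1` B) (sin (s * Xc w))%:E = 0)%E.
Proof.
move=> mB; transitivity (\int[P]_(w in Y @^-1` B) (cst (0 : R) w)%:E)%E; last exact: integral0.
apply: laplace_unique => //; first exact: finite_measure_integrable_cst.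
move=> l l0; rewrite sin_transform//.
by under eq_Rintegral do rewrite mul0r; rewrite Rintegral_cst// mul0r.
Qed.

Lemma conditional_shift_bound s x B : measurable B ->
  (\int[P]_(w in Y @^-1` B) (1 + cos (s * (X w - x)))%:E <=
   (1 + C * (oneDsqr s)^-1)%:E * P (Y @^-1` B))%E.
Proof.
move=> mB; have mD := mpre mB; set x0 := x - m / theta.
have iS f : P.-integrable setT (EFin \o f) -> P.-integrable (Y @^-1` B) (EFin \o f).
  by move=> h; apply: integrableS h.
have i1 := iS _ intg1; have ic := iS _ (icos s); have is_ := iS _ (isin s).
rewrite (eq_integral (fun w => 1%:E + ((cos (s * x0))%:E * (cos (s * Xc w))%:E +
     (sin (s * x0))%:E * (sin (s * Xc w))%:E))%E); last first.
  move=> w _; rewrite -!EFinM -!EFinD; congr EFin; congr (1 + _).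
  by rewrite (_ : s * (X w - x) = s * Xc w - s * x0) ?cosB; [ring|rewrite /Xc /x0; ring].
have i2 := integrableZl mD (cos (s * x0)) ic.
have i3 := integrableZl mD (sin (s * x0)) is_.
rewrite integralD//; last exact: integrableD.
rewrite integralD// !integralZl// conditional_sin// mule0 adde0.
rewrite integral_cst// EFinD muleDl//; last exact: fin_num_measure.
rewrite leeD2l//.
have /andP[c0 c1] := conditional_char_bound s mB.
apply: le_trans c1; rewrite -[leRHS]mul1e.
by rewrite lee_wpmul2r// lee_fin cos_le1.
Qed.

(** The Poisson kernel is the integral of [expR (- (h * s)) * cos (s * z)] over [s >= 0]; exchanging
    integrals replaces the cosine by its conditional bound. The constant is independent of [h] and
    [x], with [pi / 2] the integral of [(oneDsqr s)^-1] over the half-line. *)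
Lemma poisson_bound h x B : 0 < h -> measurable B ->
  (\int[P]_(w in Y @^-1` B) (h / (h ^+ 2 + (X w - x) ^+ 2))%:E <=
   (C * (pi / 2))%:E * P (Y @^-1` B))%E.
Proof.
move=> h0 mB; have mD := mpre mB; set p := P (Y @^-1` B).
have pfin : p \is a fin_num by exact: fin_num_measure.
have k0 w := cauchy_kernel_ge0 (X w - x) h0.
have mz : measurable_fun setT (fun w => X w - x) by exact: measurable_funB.
have mk := measurable_cauchy_kernel h0 mz.
have pos : (0 <= p)%E by exact: measure_ge0.
pose f (z : T * measurableTypeR R) : \bar R :=
  (expR (- (h * z.2)) * (1 + cos (z.2 * (X z.1 - x))) * \1_(Y @^-1` B) z.1 * \1_(`[0%R, +oo[) z.2)%:E.
have m1 : measurable_fun setT (fun z : T * measurableTypeR R => z.1) by exact: measurable_fst.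
have m2 : measurable_fun setT (fun z : T * measurableTypeR R => z.2) by exact: measurable_snd.
have mf : measurable_fun setT f.
  apply/measurable_EFinP; apply: measurable_funM; last first.
    by apply: (measurableT_comp _ m2); exact: measurable_indic.
  apply: measurable_funM; last first.
    by apply: (measurableT_comp _ m1); exact: measurable_indic.
  apply: measurable_funM; first exact: measurable_expR_scale.
  apply: measurable_funD => //; apply: measurableT_comp.
    by apply: continuous_measurable_fun; exact: continuous_cos.
  by apply: measurable_funM => //; exact: (measurableT_comp mz m1).
have cos1 (y : R) : 0 <= 1 + cos y by have := cos_geN1 y; lra.
have f0 z : (0 <= f z)%E.
  rewrite lee_fin; apply: mulr_ge0; last by rewrite indicE.
  apply: mulr_ge0; last by rewrite indicE.
  by apply: mulr_ge0; [exact: expR_ge0|exact: cos1].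
have := @fubini_tonelli _ _ _ _ _ P leb f mf f0.
have E1 : (\int[P]_w \int[leb]_s f (w, s) =
    \int[P]_(w in Y @^-1` B) (h^-1 + h / (h ^+ 2 + (X w - x) ^+ 2))%:E)%E.
  rewrite [RHS]integral_mkcond; apply: eq_integral => w _.
  rewrite patchE; case: ifPn => wB; last first.
    rewrite (eq_integral (fun=> 0%E)) ?integral0// => s _.
    by rewrite /f/= indicE (negbTE wB) mulr0 mul0r.
  rewrite -integral_poisson_kernel// [RHS]integral_mkcond; apply: eq_integral => s _.
  rewrite patchE /f/= !indicE wB mulr1.
  by case: ifPn => sp; rewrite ?mulr1 ?mulr0.
have mo : measurable_fun setT (fun s : measurableTypeR R => C * (oneDsqr s)^-1).
  apply: measurable_funM => //; apply: continuous_measurable_fun.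
  exact: continuous_oneDsqrV.
have me : measurable_fun setT (fun s : measurableTypeR R => expR (- (h * s))).
  by apply: (@measurable_expR_scale _ (measurableTypeR R)).
have o0 s : 0 <= C * (oneDsqr s)^-1 by rewrite mulr_ge0// invr_ge0.
have pE : p = (fine p)%:E by rewrite fineK.
have E2 : (\int[leb]_s \int[P]_w f (w, s) <= (h^-1 + C * (pi / 2))%:E * p)%E.
  pose g (s : measurableTypeR R) := (((expR (- (h * s)))%:E + (C * (oneDsqr s)^-1)%:E) * p)%E.
  apply: (@le_trans _ _ (\int[leb]_(s in `[0%R, +oo[) g s)%E).
    apply: (@le_trans _ _ (\int[leb]_s (g \_ `[0%R, +oo[) s)%E); last by rewrite -integral_mkcond.
    apply: ge0_le_integral => //.
    - by move=> s _; apply: integral_ge0 => w _.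
    - exact: (@measurable_fun_fubini_tonelli_G _ _ _ _ _ P f mf f0).
    - apply/(measurable_restrictT _ _).1 => //; apply: measurable_funTS.
      rewrite /g pE (_ : (fun s => _) = EFin \o
        (fun s => (expR (- (h * s)) + C * (oneDsqr s)^-1) * fine p)).
        by apply/measurable_EFinP; apply: measurable_funM => //; exact: measurable_funD.
      by apply/funext => s /=; rewrite -EFinD -EFinM.
    - move=> s _; rewrite patchE; case: ifPn => sp; last first.
        rewrite (eq_integral (fun=> 0%E)) ?integral0// => w _.
        by rewrite /f/= [X in _ * X]indicE (negbTE sp) mulr0.
      have {}sp : 0 <= s by move: sp; rewrite inE/= in_itv/= andbT.
      rewrite (_ : (\int[P]_w f (w, s) = (expR (- (h * s)))%:E *
          \int[P]_(w in Y @^-1` B) (1 + cos (s * (X w - x)))%:E)%E); last first.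
        rewrite -ge0_integralZl; [|exact: mD| | |by rewrite lee_fin expR_ge0]; last first.
        - by move=> w _; rewrite lee_fin.
        - apply/measurable_EFinP; apply: measurable_funTS; apply: measurable_funD => //.
          exact: measurable_cos_scale.
        rewrite [RHS]integral_mkcond; apply: eq_integral => w _.
        rewrite patchE /f/= !indicE [X in _ * X](_ : _ = 1) ?mulr1; last first.
          by rewrite mem_set//= in_itv/= sp.
        by case: ifPn => wB; rewrite ?mulr1 ?mulr0 ?EFinM.
      apply: (@le_trans _ _ ((expR (- (h * s)))%:E * ((1 + C * (oneDsqr s)^-1)%:E * p))%E).
        by rewrite lee_wpmul2l ?lee_fin ?expR_ge0// conditional_shift_bound.
      (* On the decaying part the damping factor is bounded by 1, which removes the dependence on
         [h]; on the constant part it is kept and integrates to [h^-1]. *)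
      rewrite /g muleA -EFinM -EFinD lee_wpmul2r// lee_fin mulrDr mulr1 lerD2l.
      by rewrite ler_piMl// expR_le1 oppr_le0 mulr_ge0// ltW.
  rewrite ge0_integralZr//; last 2 first.
  - by apply/measurable_funTS/emeasurable_funD; exact/measurable_EFinP.
  - by move=> s _; rewrite -EFinD lee_fin addr_ge0 ?expR_ge0.
  rewrite ge0_integralD//; last 3 first.
  - by apply: measurable_funTS; exact/measurable_EFinP.
  - by move=> s _; rewrite lee_fin.
  - by apply: measurable_funTS; exact/measurable_EFinP.
  rewrite integral_expRy//; under eq_integral do rewrite EFinM.
  rewrite ge0_integralZl//; last first.
    apply: measurable_funTS; apply/measurable_EFinP.
    by apply: continuous_measurable_fun; exact: continuous_oneDsqrV.
  by rewrite integral0y_oneDsqr -EFinM -EFinD.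
rewrite E1 => E12; move: E2; rewrite -E12.
(* The contribution of the auxiliary summand 1 is [h^-1 * p] on both sides, and cancels. *)
under eq_integral do rewrite EFinD.
rewrite ge0_integralD//; last 3 first.
- by move=> w _; rewrite lee_fin invr_ge0 ltW.
- by move=> w _; rewrite lee_fin.
- by apply: measurable_funTS; exact/measurable_EFinP.
have h1 : (0 <= h^-1%:E)%E by rewrite lee_fin invr_ge0 ltW.
have h2 : (0 <= (C * (pi / 2))%:E)%E.
  by rewrite lee_fin mulr_ge0// divr_ge0// ltW// pi_gt0.
rewrite integral_cst// EFinD ge0_muleDl//.
by rewrite leeD2lE// fin_numM.
Qed.

(** With [h = v - u], the indicator of [[u, v[] is at most [2 * h] times the Poisson kernel of width
    [h] centred at [u], because [h ^+ 2 + z ^+ 2 <= 2 * h ^+ 2] for [0 <= z <= h]. *)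
Lemma rectangle_bound (B : set R) (u v : R) : measurable B -> u <= v ->
  (P (Y @^-1` B `&` X @^-1` `[u, v[) <= (2 * (v - u) * (C * (pi / 2)))%:E * P (Y @^-1` B))%E.
Proof.
move=> mB; rewrite le_eqVlt => /predU1P[->|uv].
  by rewrite set_itv_ge ?bnd_simp ?ltxx// preimage_set0 setI0 measure0 subrr mulr0 mul0r mul0e.
have mI : measurable (X @^-1` `[u, v[).
  by rewrite -[X in measurable X]setTI; apply: mX => //; exact: measurable_itv.
have mD := mpre mB; set h := v - u; have h0 : 0 < h by rewrite subr_gt0.
rewrite setIC -[P _]integral_indic// ?setIC//.
rewrite EFinM -muleA; apply: (@le_trans _ _ ((2 * h)%:E *
    \int[P]_(w in Y @^-1` B) (h / (h ^+ 2 + (X w - u) ^+ 2))%:E)%E); last first.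
  by rewrite lee_wpmul2l ?poisson_bound// lee_fin mulr_ge0// ltW.
have k0 w := cauchy_kernel_ge0 (X w - u) h0.
have mz : measurable_fun setT (fun w => X w - u) by exact: measurable_funB.
have mk := measurable_cauchy_kernel h0 mz.
have h2 : 0 <= 2 * h by rewrite mulr_ge0// ltW.
rewrite -ge0_integralZl; [|exact: mD|by apply: measurable_funTS; exact/measurable_EFinP|
  by move=> w _; rewrite lee_fin|by rewrite lee_fin].
apply: ge0_le_integral => //.
- by apply/measurable_EFinP; apply: measurable_funTS; exact: measurable_indic.
- by apply: measurable_funTS; apply/measurable_EFinP; exact: measurable_funM.
move=> w Bw; rewrite -EFinM lee_fin indicE.
case: (boolP (w \in _)) => [|_]; last by rewrite mulr_ge0.
rewrite inE/= in_itv/= => /andP[uX Xv].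
have z0 : 0 <= X w - u by rewrite subr_ge0.
have zh : X w - u <= h by rewrite lerD2r ltW.
rewrite mulrA ler_pdivlMr ?mul1r; last by rewrite ltr_wpDr ?sqr_ge0// exprn_gt0.
by move: (X w - u) z0 zh => z z0 zh; nra.
Qed.

Lemma null_dominates_YX : (forall B : set R, measurable B -> leb B = 0%E -> P (Y @^-1` B) = 0%E) ->
  forall A : set (measurableTypeR R * measurableTypeR R), measurable A ->
  (leb \x leb)%E A = 0%E -> P ((fun w => (Y w, X w)) @^-1` A) = 0%E.
Proof.
move=> Ynull A mA A0.
have mYX : measurable_fun setT (fun w => (Y w, X w) : measurableTypeR R * measurableTypeR R).
  exact: measurable_fun_pair.
pose mu := measure_function_pushforward__canonical__measure_function_Measure P mYX.
have mu_fin : (mu setT < +oo)%E.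
  by rewrite /mu/= /pushforward preimage_setT probability_setT ltry.
have K0 : 0 <= 2 * (C * (pi / 2)).
  by rewrite mulr_ge0// mulr_ge0// divr_ge0// ltW// pi_gt0.
pose PY := measure_function_pushforward__canonical__measure_function_Measure P
  (mY : measurable_fun setT (Y : T -> measurableTypeR R)).
pose nu : {measure set (measurableTypeR R * measurableTypeR R) -> \bar R} :=
  product_measure1 (mscale (NngNum K0) PY) leb.
have PYE B : mscale (NngNum K0) PY B = ((2 * (C * (pi / 2)))%:E * P (Y @^-1` B))%E by [].
have mI (u v : R) : measurable (`[u, v[%classic : set (measurableTypeR R)) by exact: measurable_itv.
have lebI (u v : R) : u <= v -> leb `[u, v[%classic = (v - u)%:E.
  move=> uv; rewrite lebesgue_measure_itv/= lte_fin; case: ltP => [_|vu]; first by rewrite -EFinB.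
  by rewrite (@le_anti _ _ u v) ?uv// subrr.
have nuE (B : set (measurableTypeR R)) (u v : R) : measurable B -> u <= v ->
    nu (B `*` `[u, v[%classic) = ((2 * (C * (pi / 2)))%:E * P (Y @^-1` B) * (v - u)%:E)%E.
  move=> mB uv; transitivity (mscale (NngNum K0) PY B * leb `[u, v[%classic)%E.
    by apply: product_measure1E => //; exact: mI.
  by rewrite PYE; congr (_ * _)%E; exact: lebI.
have muE (B : set (measurableTypeR R)) (u v : R) :
  mu (B `*` `[u, v[%classic) = P (Y @^-1` B `&` X @^-1` `[u, v[) by [].
(* [nu] is infinite because of its Lebesgue factor, while comparison on rectangles needs finite
   measures: hence the restriction to horizontal strips in [x]. *)
pose S n : set (measurableTypeR R * measurableTypeR R) := setT `*` `[- n%:R, n%:R[%classic.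
have mS n : measurable (S n) by apply: measurableX; [exact: measurableT|exact: mI].
(* By Tonelli almost every section of [A] at fixed [y] is null, and [Ynull] makes the exceptional
   set of [y] null for the law of [Y] as well. *)
have nuA : nu A = 0%E.
  have mf := measurable_fun_xsection leb mA.
  have f0 y : `|(leb \o xsection A) y|%E = (leb \o xsection A) y by rewrite gee0_abs.
  have : (\int[leb]_y `|(leb \o xsection A) y| = 0)%E.
    by rewrite -A0; apply: eq_integral => y _; exact: f0.
  move=> /(ae_eq_integral_abs leb measurableT mf)[N [mN N0 subN]].
  transitivity (\int[mscale (NngNum K0) PY]_y `|(leb \o xsection A) y|)%E.
    by apply: eq_integral => y _; rewrite f0.
  apply/(ae_eq_integral_abs _ measurableT mf); exists N; split => //.
  by apply: etrans (PYE N) _; rewrite Ynull ?mule0.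
have muS n : mu (A `&` S n) = 0%E.
  apply/eqP; rewrite eq_le measure_ge0 andbT -nuA.
  apply: (@le_trans _ _ (nu (A `&` S n))); last first.
    by apply: le_measure; rewrite ?inE//; exact: measurableI.
  have nn : - n%:R <= n%:R :> R by rewrite (@le_trans _ _ 0)// oppr_le0.
  apply: (@le_measure_rectangle R (mrestr mu (mS n)) (mrestr nu (mS n))) => //.
  - apply: le_lt_trans mu_fin; apply: (le_measure mu); rewrite ?inE//.
    exact: measurableI.
  - apply: (@le_lt_trans _ _ (nu (S n))).
      by apply: (le_measure nu); rewrite ?inE//; exact: measurableI.
    by rewrite /S nuE// preimage_setT probability_setT mule1 -EFinM ltry.
  - move=> B u v mB uv; change (mu ((B `*` `[u, v[%classic) `&` S n) <=
      nu ((B `*` `[u, v[%classic) `&` S n))%E.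
    have -> : (B `*` `[u, v[%classic) `&` S n =
        B `*` `[Num.max u (- n%:R), Num.min v n%:R[%classic.
      apply/seteqP; split => -[y x] /=; rewrite !in_itv/= ge_max lt_min.
        by move=> [[By /andP[-> ->]] [_]]; rewrite /= in_itv/= => /andP[-> ->].
      move=> [By /andP[/andP[-> nx] /andP[-> xn]]].
      by do 2!split => //; rewrite /= in_itv/= nx.
    have [uv'|uv'] := leP (Num.max u (- n%:R)) (Num.min v n%:R); last first.
      by rewrite set_itv_ge ?setX0 ?measure0// bnd_simp -leNgt ltW.
    rewrite nuE// muE; apply: (le_trans (rectangle_bound mB uv')).
    by rewrite muleAC -EFinM mulrAC.
have -> : P ((fun w => (Y w, X w)) @^-1` A) = mu A by [].
have AE : A = \bigcup_n (A `&` S n).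
  apply/seteqP; split => [[y x] Ayx|z [n _ []]//].
  exists (Num.truncn `|x|).+1 => //; split => //; split => //=; rewrite in_itv/=.
  have := truncnS_gt `|x|; rewrite ltr_norml => /andP[h1 h2].
  by rewrite ltW.
apply: measure_negligible => //; rewrite AE; apply: negligible_bigcup => n.
by exists (A `&` S n); split; [exact: measurableI|exact: muS|].
Qed.

End absolutely_continuous_law.

(** The transform is known only at nonnegative arguments, so it is compared with a formula [F],
    differentiable at [l], along the points [l + n.+1%:R^-1]. *)
Lemma cvg_right_diffquot (R : realType) (F : R -> R) (l d u : R) (v : nat -> R) :
  is_derive l 1 F d -> u = F l -> (forall n, v n = F (l + n.+1%:R^-1)) ->
  n.+1%:R * (u - v n) @[n --> \oo] --> - d.
Proof.
move=> dF uE vE.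
have n0 n : n.+1%:R^-1 != 0 :> R by rewrite invr_eq0 pnatr_eq0.
rewrite (_ : (fun n => _) = (fun n => - ((F (l + n.+1%:R^-1) - F l) / n.+1%:R^-1))).
  by apply: cvgN; exact: (cvg_diffquot dF n0 (@cvg_harmonic R)).
by apply/funext => n; rewrite uE vE invrK -mulNr opprB mulrC.
Qed.

(** * The Gamma law of [Y] and its moments *)

Section law_of_Y.
Context {R : realType} {d} {T : measurableType d} (P : probability T R).
Local Notation leb := (@lebesgue_measure R).
Local Notation intg f := (P.-integrable setT (EFin \o f)).
Variables (Y : T -> R) (s r : R).
Hypotheses (mY : measurable_fun setT Y) (Y_ge0 : forall w, 0 <= Y w).
Hypotheses (s_gt0 : 0 < s) (r_gt0 : 0 < r).
Hypothesis laplace_Y : forall l, 0 <= l -> \int[P]_w expR (- (l * Y w)) = (1 + l / r) `^ (- s).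

Let intg1 : intg (cst 1).
Proof. exact: finite_measure_integrable_cst. Qed.

Lemma gamma_law A : measurable A -> P (Y @^-1` A) = gamma_prob s r A.
Proof.
move=> mA.
have mYA : measurable (Y @^-1` A) by rewrite -[X in measurable X]setTI; exact: mY.
have m_abs : measurable_fun setT (fun x : measurableTypeR R => `|x|).
  exact: measurableT_comp.
have <- : (\int[P]_(w in Y @^-1` A) (cst (1 : R) w)%:E)%E = P (Y @^-1` A).
  by have := @integral_cst _ _ _ P (Y @^-1` A) mYA 1%E; rewrite mul1e.
rewrite (@laplace_unique _ _ _ _ _ P leb (cst 1) Y (gamma_pdf s r) (fun x => `|x|) mY m_abs)//.
- have mB : measurable ((fun x : R => `|x|) @^-1` A).
    by rewrite -[X in measurable X]setTI; exact: m_abs.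
  rewrite /gamma_prob [LHS]integral_mkcond [RHS]integral_mkcond.
  apply: eq_integral => x _; rewrite /patch.
  have [x0|x0] := ltP 0 x.
    suff -> : (x \in (fun x : R => `|x|) @^-1` A) = (x \in A) by [].
    by apply/idP/idP; rewrite !inE/= gtr0_norm.
  have -> : gamma_pdf s r x = 0.
    by rewrite /gamma_pdf patchE memNset//= in_itv/= andbT ltNge x0.
  by do 2!case: ifP.
- exact: integrable_gamma_pdf.
- move=> l l0; rewrite gamma_pdf_laplace// -laplace_Y//.
  by apply: eq_Rintegral => w _; rewrite mul1r.
Qed.

Lemma gamma_law_null A : measurable A -> leb A = 0%E -> P (Y @^-1` A) = 0%E.
Proof.
move=> mA A0; rewrite gamma_law// /gamma_prob; apply: null_set_integral => //.
by apply: measurable_funTS; apply: (measurable_int leb); exact: integrable_gamma_pdf.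
Qed.

Lemma is_derive_onePdiv_powR (l p : R) : 0 <= l ->
  is_derive l 1 (fun l => (1 + l / r) `^ p) (p * (1 + l / r) `^ (p - 1) / r).
Proof.
move=> l0; have p0 : 0 < 1 + l / r by rewrite ltr_wpDr// divr_ge0// ltW.
have D1 : is_derive l 1 (fun l => 1 + l / r) r^-1.
  by apply: is_derive_eq; rewrite /GRing.scale/= mulr1; ring.
exact: (@is_derive1_comp _ (fun y => y `^ p) _ l _ _ (is_derive1_powR p p0) D1).
Qed.

(** The exponential factor is kept for all [l >= 0] so that the induction can differentiate again in
    [l]; moments are the case [l = 0]. *)
Lemma gamma_moment_laplace n : intg (fun w => Y w ^+ n) /\
  forall l, 0 <= l -> \int[P]_w (Y w ^+ n * expR (- (l * Y w))) =
    (\prod_(k < n) ((s + k%:R) / r)) * (1 + l / r) `^ (- (s + n%:R)).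
Proof.
elim: n => [|n [iY hY]].
  split; first exact: intg1.
  move=> l l0; rewrite big_ord0 mul1r addr0 -laplace_Y//.
  by apply: eq_Rintegral => w _; rewrite expr0 mul1r.
set c := \prod_(k < n) _ in hY.
have step l : 0 <= l -> intg (fun w => (Y w ^+ n * expR (- (l * Y w))) * Y w) /\
    \int[P]_w ((Y w ^+ n * expR (- (l * Y w))) * Y w) =
    c * ((s + n%:R) * (1 + l / r) `^ (- (s + n%:R) - 1) / r).
  move=> l0; apply: (laplace_moment mY Y_ge0) => [|w|].
  - exact: intg_expR.
  - by rewrite mulr_ge0 ?exprn_ge0 ?expR_ge0.
  rewrite (_ : c * _ = - (c * (- (s + n%:R) * (1 + l / r) `^ (- (s + n%:R) - 1) / r))); last by ring.
  apply: (@cvg_right_diffquot _ (fun l => c * (1 + l / r) `^ (- (s + n%:R))) l).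
  - have D1 := is_derive_onePdiv_powR (- (s + n%:R)) l0.
    by apply: is_derive_eq; rewrite /GRing.scale.
  - exact: hY.
  - move=> k; rewrite -hY ?addr_ge0 ?invr_ge0//.
    by apply: eq_Rintegral => w _; rewrite -mulrA -expRD; congr (_ * expR _); ring.
have E l : (\prod_(k < n.+1) ((s + k%:R) / r)) * (1 + l / r) `^ (- (s + n.+1%:R)) =
    c * ((s + n%:R) * (1 + l / r) `^ (- (s + n%:R) - 1) / r).
  by rewrite big_ord_recr/= -/c -natr1 addrA opprD; ring.
split=> [|l l0].
  have [] := step 0 (lexx 0); rewrite (_ : EFin \o _ = EFin \o (fun w => Y w ^+ n.+1))//.
  by apply/funext => w /=; rewrite mul0r oppr0 expR0 mulr1 exprSr.
rewrite E -(step _ l0).2; apply: eq_Rintegral => w _; rewrite exprSr; ring.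
Qed.

End law_of_Y.

(** * Moments of the limit law *)

Section joint_moments.
Context {R : realType} {d} {T : measurableType d} (P : probability T R).
Local Notation intg f := (P.-integrable setT (EFin \o f)).
Variables (a b m theta : R).
Hypotheses (a_gt0 : 0 < a) (b_gt0 : 0 < b) (theta_gt0 : 0 < theta).
Variables (Y X : T -> R).
Hypotheses (mY : measurable_fun setT Y) (mX : measurable_fun setT X).
Hypothesis (Y_ge0 : forall w, 0 <= Y w).
Let Xc w := X w - m / theta.
Let D s := dser b theta (s ^+ 2).
Let E s := eser b theta (s ^+ 2).
Hypothesis cos_transform : forall l s, 0 <= l ->
  \int[P]_w (cos (s * Xc w) * expR (- (l * Y w))) = ((E s + l * D s / 2) / b) `^ (- (2 * a)).
Hypothesis sin_transform : forall l s, 0 <= l ->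
  \int[P]_w (sin (s * Xc w) * expR (- (l * Y w))) = 0.

Let mXc : measurable_fun setT Xc. Proof. exact: measurable_funB. Qed.

Let intg1 : intg (cst 1).
Proof. exact: finite_measure_integrable_cst. Qed.

Let eq_intg f g : f =1 g -> intg f -> intg g.
Proof. by move=> /funext ->. Qed.

Let lapY := laplace_Y b_gt0 cos_transform.

Let b2_gt0 : 0 < 2 * b. Proof. by rewrite mulr_gt0. Qed.

Let integral_cos s : \int[P]_w cos (s * Xc w) = (b^-1 * E s) `^ (- (2 * a)).
Proof.
have := cos_transform s (lexx 0); rewrite !mul0r addr0 [E s / b]mulrC => <-.
by apply: eq_Rintegral => w _; rewrite mul0r oppr0 expR0 mulr1.
Qed.

Let integral_sin s : \int[P]_w sin (s * Xc w) = 0.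
Proof.
rewrite -(sin_transform s (lexx 0)).
by apply: eq_Rintegral => w _; rewrite mul0r oppr0 expR0 mulr1.
Qed.

Let intg_even n : intg (fun w => Xc w ^+ (2 * n)).
Proof.
apply: (@smooth_char_moments _ _ _ P Xc (fun s => psum (fun k => b^-1 * ecoef b theta k) (s ^+ 2)
    `^ (- (2 * a))) mXc).
- by apply: le_lt_trans (probability_le1 P measurableT) (ltry 1).
- apply: smooth_powR => [|q q0]; first by apply: entireZ; exact: entire_ecoef.
  rewrite psumZ; last exact: entire_ecoef.
  by rewrite mulr_gt0 ?invr_gt0//; exact: eser_gt0.
- by move=> s; rewrite psumZ ?integral_cos//; exact: entire_ecoef.
Qed.

Let intg_Y n : intg (fun w => Y w ^+ n).
Proof. exact: (gamma_moment_laplace mY Y_ge0 b2_gt0 lapY n).1. Qed.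

Lemma joint_moment_integrable n p : intg (fun w => Y w ^+ n * Xc w ^+ p).
Proof.
apply: (@le_intg _ _ _ _ _ (fun w => Y w ^+ (2 * n) + Xc w ^+ (2 * p))).
- by apply: measurable_funM; apply: measurable_funX.
- move=> w; rewrite mulnC exprM [(2 * p)%N]mulnC exprM normrM.
  rewrite -[X in X + _]real_normK ?num_real// -[X in _ + X]real_normK ?num_real//.
  have := sqr_ge0 (`|Y w ^+ n| - `|Xc w ^+ p|); rewrite sqrrB.
  have := mulr_ge0 (normr_ge0 (Y w ^+ n)) (normr_ge0 (Xc w ^+ p)); lra.
- exact: (integrableD measurableT (intg_Y _) (intg_even _)).
Qed.

Let normX_le w p : `|X w| ^+ p <= 2 ^+ p * (1 + Xc w ^+ (2 * p) + `|m / theta| ^+ p).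
Proof.
have -> : X w = Xc w + m / theta by rewrite subrK.
apply: (@le_trans _ _ ((2 * Num.max `|Xc w| `|m / theta|) ^+ p)).
  rewrite lerXn2r ?nnegrE ?mulr_ge0// ?le_max ?normr_ge0//.
  rewrite (le_trans (ler_normD _ _))// mulrDl !mul1r.
  by apply: lerD; rewrite le_max lexx ?orbT.
rewrite exprMn ler_wpM2l ?exprn_ge0//.
have Xp : `|Xc w| ^+ p <= 1 + Xc w ^+ (2 * p).
  rewrite mulnC exprM -normrX -[X in _ + X]real_normK ?num_real//.
  have := sqr_ge0 (`|Xc w ^+ p| - 1); rewrite sqrrB1.
  have := normr_ge0 (Xc w ^+ p); lra.
have := exprn_ge0 p (normr_ge0 (m / theta)).
have : 0 <= Xc w ^+ (2 * p) by rewrite exprM exprn_ge0// sqr_ge0.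
by case: (leP `|Xc w| `|m / theta|) => _; lra.
Qed.

Lemma abs_moment_integrable n p : intg (fun w => Y w ^+ n * `|X w| ^+ p).
Proof.
apply: (@le_intg _ _ _ _ _ (fun w => (2 ^+ p * (1 + `|m / theta| ^+ p)) * Y w ^+ n +
    2 ^+ p * (Y w ^+ n * Xc w ^+ (2 * p)))).
- apply: measurable_funM; apply: measurable_funX => //.
  exact: measurableT_comp.
- move=> w; rewrite ger0_norm; last by rewrite mulr_ge0 ?exprn_ge0.
  apply: le_trans (ler_wpM2l (exprn_ge0 n (Y_ge0 w)) (normX_le w p)) _.
  by rewrite le_eqVlt; apply/orP; left; apply/eqP; ring.
- have i1 := integrableZl measurableT (2 ^+ p * (1 + `|m / theta| ^+ p)) (intg_Y n).
  have i2 := integrableZl measurableT (2 ^+ p) (joint_moment_integrable n (2 * p)).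
  exact: (integrableD measurableT i1 i2).
Qed.

Lemma expectation_Y : \int[P]_w Y w = a / b.
Proof.
have := (gamma_moment_laplace mY Y_ge0 b2_gt0 lapY 1).2 _ (lexx 0).
rewrite mul0r addr0 powR1 mulr1 big_ord1 addr0 => EY1.
transitivity (2 * a / (2 * b)); last by field; rewrite gt_eqF.
by rewrite -EY1; apply: eq_Rintegral => w _; rewrite mul0r oppr0 expR0 mulr1.
Qed.

Lemma expectation_Y2 : \int[P]_w Y w ^+ 2 = a * (2 * a + 1) / (2 * b ^+ 2).
Proof.
have := (gamma_moment_laplace mY Y_ge0 b2_gt0 lapY 2).2 _ (lexx 0).
rewrite mul0r addr0 powR1 mulr1 big_ord_recr big_ord1/= addr0 => EY1.
transitivity (2 * a / (2 * b) * ((2 * a + 1) / (2 * b))); last by field; rewrite gt_eqF.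
by rewrite -EY1; apply: eq_Rintegral => w _; rewrite mul0r oppr0 expR0 mulr1.
Qed.

Let intg_h_sin h : intg h -> (forall s, \int[P]_w (h w * sin (s * Xc w)) = 0) ->
  intg (fun w => h w * Xc w) -> \int[P]_w (h w * Xc w) = 0.
Proof.
move=> ih h0 ihX; have := sin_moment_cvg mXc ih ihX.
under eq_fun do rewrite h0 mulr0.
by move=> cv; apply/esym; apply: (cvg_unique _ (cvg_cst (0 : R)) cv); exact: norm_hausdorff.
Qed.

(** The right derivative in [l] at 0 of an identically vanishing sine transform. *)
Let intg_sinY s : \int[P]_w (Y w * sin (s * Xc w)) = 0.
Proof.
transitivity (\int[P]_w (sin (s * Xc w) * Y w)).
  by apply: eq_Rintegral => w _; rewrite mulrC.
have isX : intg (fun w => sin (s * Xc w)).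
  by apply: eq_intg (intg_sin s mXc intg1) => w; rewrite mul1r.
have isY : intg (fun w => sin (s * Xc w) * Y w).
  by apply: eq_intg (intg_sin s mXc (intg_Y 1)) => w; rewrite mulrC.
have := laplace_moment_cvg mY Y_ge0 isX isY.
rewrite integral_sin; under eq_fun do rewrite sin_transform ?invr_ge0// subr0 mulr0.
by move=> cv; apply/esym; apply: (cvg_unique _ (cvg_cst (0 : R)) cv); exact: norm_hausdorff.
Qed.

Lemma expectation_Xc : \int[P]_w Xc w = 0.
Proof.
rewrite -(@intg_h_sin (cst 1))//.
- by apply: eq_Rintegral => w _; rewrite mul1r.
- by move=> s; rewrite -(integral_sin s); apply: eq_Rintegral => w _; rewrite mul1r.
- by apply: eq_intg (joint_moment_integrable 0 1) => w.
Qed.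

Lemma expectation_YXc : \int[P]_w (Y w * Xc w) = 0.
Proof.
apply: intg_h_sin; [exact: (intg_Y 1)|exact: intg_sinY|].
by apply: eq_intg (joint_moment_integrable 1 1) => w.
Qed.

(** Minus the right derivative in [l] at 0 of the cosine transform. *)
Let integral_Ycos s : \int[P]_w (Y w * cos (s * Xc w)) =
  a / b * (D s * (E s / b) `^ (- (2 * a) - 1)).
Proof.
transitivity (\int[P]_w (cos (s * Xc w) * Y w)).
  by apply: eq_Rintegral => w _; rewrite mulrC.
have ic : intg (fun w => cos (s * Xc w)).
  by apply: eq_intg (intg_cos s mXc intg1) => w; rewrite mul1r.
have icY : intg (fun w => cos (s * Xc w) * Y w).
  by apply: eq_intg (intg_cos s mXc (intg_Y 1)) => w; rewrite mulrC.
have cv := laplace_moment_cvg mY Y_ge0 ic icY.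
apply: (cvg_unique _ cv); first exact: norm_hausdorff.
pose F l := ((E s + l * D s / 2) / b) `^ (- (2 * a)).
have E0 : 0 < (E s + 0 * D s / 2) / b.
  by rewrite !mul0r addr0 divr_gt0//; apply: eser_gt0 => //; exact: sqr_ge0.
have dF : is_derive (0 : R) 1 F
    (- (2 * a) * ((E s + 0 * D s / 2) / b) `^ (- (2 * a) - 1) * (D s / (2 * b))).
  have D1 : is_derive (0 : R) 1 (fun l => (E s + l * D s / 2) / b) (D s / (2 * b)).
    by apply: is_derive_eq; rewrite /GRing.scale/= mulr1; field; rewrite gt_eqF.
  exact: (@is_derive1_comp _ (fun y => y `^ (- (2 * a))) _ (0 : R) _ _ (is_derive1_powR _ E0) D1).
rewrite (_ : a / b * _ = - (- (2 * a) * ((E s + 0 * D s / 2) / b) `^ (- (2 * a) - 1) *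
    (D s / (2 * b)))); last by rewrite !mul0r addr0; field; rewrite gt_eqF.
apply: (cvg_right_diffquot dF).
  by rewrite /F !mul0r addr0 integral_cos mulrC.
by move=> n; rewrite add0r cos_transform// invr_ge0.
Qed.

(** When the cosine transform is a function [f] of [s ^+ 2], its second difference quotient at 0
    with step [n.+1%:R^-1] is [-2] times a first difference quotient of [f] with step
    [n.+1%:R ^- 2]. A single derivative of [f] is enough. *)
Let integral_sqr h (f : R -> R) (d1 : R) : intg h -> intg (fun w => h w * Xc w ^+ 2) ->
  (forall s, \int[P]_w (h w * cos (s * Xc w)) = f (s ^+ 2)) ->
  is_derive (0 : R) 1 f d1 -> \int[P]_w (h w * Xc w ^+ 2) = - 2 * d1.
Proof.
move=> ih ihX hf df; have cv := cos_moment_cvg mXc ih ihX.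
apply: (cvg_unique _ cv); first exact: norm_hausdorff.
have n0 n : n.+1%:R ^- 2 != 0 :> R by rewrite invr_eq0 expf_neq0// pnatr_eq0.
have nc : n.+1%:R ^- 2 @[n --> \oo] --> (0 : R).
  rewrite (_ : (fun n => _) = (fun n => harmonic n * harmonic n)); last first.
    by apply/funext => n; rewrite -exprVn expr2.
  by have := cvgM (@cvg_harmonic R) (@cvg_harmonic R); rewrite mul0r; apply.
have dq := cvg_diffquot df n0 nc.
rewrite (_ : (fun n => _) = (fun n => -2 * ((f (0 + n.+1%:R ^- 2) - f 0) / n.+1%:R ^- 2))).
  by apply: cvgMr.
apply/funext => n; rewrite hf add0r exprVn invrK.
have -> : \int[P]_x h x = f 0.
  have := hf 0; rewrite expr0n/= => <-.
  by apply: eq_Rintegral => w _; rewrite mul0r cos0 mulr1.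
by ring.
Qed.

Let der_powR (p : R) : is_derive (0 : R) 1 (fun q => (eser b theta q / b) `^ p) (p / (8 * theta * b)).
Proof.
have E0 : eser b theta 0 / b = 1 by rewrite eser0 divff// gt_eqF.
have E0' : 0 < eser b theta 0 / b by rewrite E0.
have D1 := is_derive_eser b_gt0 theta_gt0 0; rewrite dser0 in D1.
have D2 : is_derive (0 : R) 1 (fun q => eser b theta q / b) (1 / (8 * theta) / b).
  by apply: is_derive_eq; rewrite /GRing.scale/=; field; rewrite !gt_eqF.
have := @is_derive1_comp _ (fun y => y `^ p) (fun q => eser b theta q / b) (0 : R) _ _
  (is_derive1_powR p E0') D2.
rewrite E0 powR1 => D3; apply: is_derive_eq.
by field; rewrite !gt_eqF.
Qed.

Lemma expectation_Xc2 : \int[P]_w Xc w ^+ 2 = a / (2 * b * theta).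
Proof.
transitivity (\int[P]_w (cst 1 w * Xc w ^+ 2)).
  by apply: eq_Rintegral => w _; rewrite mul1r.
rewrite (integral_sqr intg1 _ _ (der_powR (- (2 * a)))).
- by field; rewrite !gt_eqF.
- by apply: eq_intg (joint_moment_integrable 0 2) => w.
- move=> s; rewrite -[_ / b]mulrC -integral_cos.
  by apply: eq_Rintegral => w _; rewrite mul1r.
Qed.

Lemma expectation_YXc2 : \int[P]_w (Y w * Xc w ^+ 2) =
  2 * a / b * ((2 * a + 1) / (8 * theta * b) - (8 * theta * (b + 2 * theta))^-1).
Proof.
have D1 := is_derive_dser b_gt0 theta_gt0 0; rewrite ddser0// in D1.
have D2 := der_powR (- (2 * a) - 1).
have D3 : is_derive (0 : R) 1
    (fun q => a / b * (dser b theta q * (eser b theta q / b) `^ (- (2 * a) - 1)))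
    (a / b * ((8 * theta * (b + 2 * theta))^-1 + (- (2 * a) - 1) / (8 * theta * b))).
  apply: is_derive_eq; rewrite /GRing.scale/= dser0 eser0 divff ?gt_eqF// powR1.
  by ring.
rewrite (integral_sqr _ _ _ D3).
- by field; rewrite !gt_eqF//= addr_gt0 ?mulr_gt0.
- exact: (intg_Y 1).
- by apply: eq_intg (joint_moment_integrable 1 2) => w.
- exact: integral_Ycos.
Qed.

Let XE w : X w = Xc w + m / theta. Proof. by rewrite subrK. Qed.

Let iXc : intg Xc.
Proof. by apply: eq_intg (joint_moment_integrable 0 1) => w; rewrite mul1r. Qed.

Let integral_cst c : \int[P]_w cst c w = c :> R.
Proof.
rewrite Rintegral_cst//; transitivity (c * fine (P setT)) => //.
by rewrite probability_setT mulr1.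
Qed.

Lemma expectation_X : \int[P]_w X w = m / theta.
Proof.
transitivity (\int[P]_w (Xc w + cst (m / theta) w)).
  by apply: eq_Rintegral => w _; rewrite XE.
rewrite RintegralD//; last exact: finite_measure_integrable_cst.
by rewrite expectation_Xc add0r integral_cst.
Qed.

Lemma expectation_YX : \int[P]_w (Y w * X w) = m * a / (theta * b).
Proof.
have i1 : intg (fun w => m / theta * Y w) by exact: (integrableZl measurableT _ (intg_Y 1)).
transitivity (\int[P]_w (Y w * Xc w + m / theta * Y w)).
  by apply: eq_Rintegral => w _; rewrite XE; ring.
rewrite RintegralD//; last exact: (joint_moment_integrable 1 1).
rewrite expectation_YXc add0r RintegralZl//; last exact: (intg_Y 1).
by rewrite expectation_Y; field; rewrite !gt_eqF.
Qed.

Lemma expectation_X2 : \int[P]_w X w ^+ 2 = (a * theta + 2 * b * m ^+ 2) / (2 * b * theta ^+ 2).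
Proof.
have i1 : intg (fun w => 2 * (m / theta) * Xc w) by exact: (integrableZl measurableT _ iXc).
have i2 : intg (cst ((m / theta) ^+ 2)) by exact: finite_measure_integrable_cst.
have i3 : intg (fun w => Xc w ^+ 2).
  by apply: eq_intg (joint_moment_integrable 0 2) => w; rewrite mul1r.
have i12 := integrableD measurableT i1 i2.
transitivity (\int[P]_w (Xc w ^+ 2 + (2 * (m / theta) * Xc w + cst ((m / theta) ^+ 2) w))).
  by apply: eq_Rintegral => w _; rewrite XE/=; ring.
rewrite RintegralD// RintegralD// RintegralZl// expectation_Xc expectation_Xc2 integral_cst.
by field; rewrite !gt_eqF.
Qed.

Lemma expectation_YX2 : \int[P]_w (Y w * X w ^+ 2) =
  a / ((b + 2 * theta) * 2 * b ^+ 2 * theta ^+ 2)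
    * (theta * (a * b + 2 * a * theta + theta) + 2 * m ^+ 2 * b * (2 * theta + b)).
Proof.
have i1 : intg (fun w => 2 * (m / theta) * (Y w * Xc w)).
  exact: (integrableZl measurableT _ (joint_moment_integrable 1 1)).
have i2 : intg (fun w => (m / theta) ^+ 2 * Y w).
  exact: (integrableZl measurableT _ (intg_Y 1)).
have i12 := integrableD measurableT i1 i2.
transitivity (\int[P]_w (Y w * Xc w ^+ 2 +
    (2 * (m / theta) * (Y w * Xc w) + (m / theta) ^+ 2 * Y w))).
  by apply: eq_Rintegral => w _; rewrite XE/=; ring.
rewrite RintegralD//; last exact: (joint_moment_integrable 1 2).
rewrite RintegralD// RintegralZl//; last exact: (joint_moment_integrable 1 1).
rewrite RintegralZl//; last exact: (intg_Y 1).
rewrite expectation_YXc expectation_YXc2 expectation_Y; field.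
by rewrite !gt_eqF//= addr_gt0// mulr_gt0.
Qed.

End joint_moments.

(** * From the complex transform to centred real transforms *)

Section centered_transform.
Context {R : realType} {d} {T : measurableType d} (P : probability T R).
Local Notation intg f := (P.-integrable setT (EFin \o f)).
Implicit Types X Y : T -> R.

Lemma expectation_Rintegral (f : T -> R) : intg f -> ('E_P[f] = (\int[P]_w f w)%:E)%E.
Proof. by move=> intgf; rewrite unlock /Rintegral fineK//; exact: integrable_fin_num. Qed.

Lemma cexpectation_cexp X Y l s (g c : R) :
  cexpectation P (fun w => cexp (Complex (- (l * Y w)) (s * X w))) = cexp (Complex (- g) c) ->
  \int[P]_w (cos (s * X w) * expR (- (l * Y w))) = expR (- g) * cos c /\
  \int[P]_w (sin (s * X w) * expR (- (l * Y w))) = expR (- g) * sin c.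
Proof.
rewrite /cexpectation /cexp /= unlock => -[hcos hsin].
by split; [rewrite -hcos|rewrite -hsin]; apply: eq_Rintegral => w _; rewrite mulrC.
Qed.

(** Rotation of the pair of cosine and sine transforms by the angle [- (s * c)]. *)
Lemma centered_transform X Y l s (g c : R) :
  measurable_fun setT X -> measurable_fun setT Y -> (forall w, 0 <= Y w) -> 0 <= l ->
  \int[P]_w (cos (s * X w) * expR (- (l * Y w))) = g * cos (s * c) ->
  \int[P]_w (sin (s * X w) * expR (- (l * Y w))) = g * sin (s * c) ->
  \int[P]_w (cos (s * (X w - c)) * expR (- (l * Y w))) = g /\
  \int[P]_w (sin (s * (X w - c)) * expR (- (l * Y w))) = 0.
Proof.
move=> mX mY Y0 l0 hcos hsin.
have i1 : intg (cst 1) by exact: finite_measure_integrable_cst.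
have ie := intg_expR mY Y0 l0 i1.
have ic : intg (fun w => cos (s * X w) * expR (- (l * Y w))).
  rewrite (_ : EFin \o _ = EFin \o (fun w => cst 1 w * expR (- (l * Y w)) * cos (s * X w))).
    exact: intg_cos.
  by apply/funext => w /=; rewrite mul1r mulrC.
have is_ : intg (fun w => sin (s * X w) * expR (- (l * Y w))).
  rewrite (_ : EFin \o _ = EFin \o (fun w => cst 1 w * expR (- (l * Y w)) * sin (s * X w))).
    exact: intg_sin.
  by apply/funext => w /=; rewrite mul1r mulrC.
have iZ (k : R) (f : T -> R) : intg f -> intg (fun w => k * f w).
  by move=> intgf; exact: (integrableZl measurableT k intgf).
have comb (p q : R) : \int[P]_w (p * (cos (s * X w) * expR (- (l * Y w))) +
      q * (sin (s * X w) * expR (- (l * Y w)))) = g * (p * cos (s * c) + q * sin (s * c)).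
  rewrite RintegralD//; [|exact: iZ..].
  by rewrite !RintegralZl// hcos hsin; ring.
split.
  transitivity (g * (cos (s * c) * cos (s * c) + sin (s * c) * sin (s * c))).
    rewrite -comb; apply: eq_Rintegral => w _; rewrite mulrBr cosB; ring.
  by rewrite -!expr2 cos2Dsin2 mulr1.
transitivity (g * (- sin (s * c) * cos (s * c) + cos (s * c) * sin (s * c))); last by ring.
rewrite -comb; apply: eq_Rintegral => w _; rewrite mulrBr sinB; ring.
Qed.

End centered_transform.

Local Open Scope complex_scope.

Theorem theorem4p2 (R : realType) (a b m theta : R)
    (a_gt0 : 0 < a) (b_gt0 : 0 < b) (theta_gt0 : 0 < theta)
    (v : R -> R -> R -> R)
    (v_sol : forall l1 l2 : R, 0 <= l1 ->
       nonneg_riccati_solution b theta l1 l2 (fun t => v t l1 l2))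
    (d : measure_display) (T : measurableType d) (P : probability T R)
    (Y X : {RV P >-> R})
    (Y_ge0 : forall w, 0 <= Y w)
    (YX_transform : forall l1 l2 : R, 0 <= l1 ->
       cexpectation P (fun w => cexp ((- (l1 * Y w)) +i* (l2 * X w))) =
       cexp ((- (a * \int[lebesgue_measure]_(s in `[0, +oo[) v s l1 l2))
             +i* (m / theta * l2))) :
  [/\ pushforward P (fun w => (Y w, X w)) `<<
        (lebesgue_measure \x lebesgue_measure)%E,
      forall l1 : R, 0 <= l1 ->
        'E_P[fun w => (expR (- (l1 * Y w)))%R]%E =
        ((1 + l1 / (2 * b)) `^ (- (2 * a)))%:E,
      forall A : set R, measurable A ->
        distribution P Y A = gamma_prob (2 * a) (2 * b) A,
      forall n p : nat,
        ('E_P[fun w => (Y w ^+ n * `|X w| ^+ p)%R] < +oo)%E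
    & [/\ 'E_P[Y]%E = (a / b)%:E,
          'E_P[X]%E = (m / theta)%:E,
          'E_P[fun w => (Y w ^+ 2)%R]%E = (a * (2 * a + 1) / (2 * b ^+ 2))%:E,
          'E_P[fun w => (Y w * X w)%R]%E = (m * a / (theta * b))%:E
        & 'E_P[fun w => (X w ^+ 2)%R]%E =
            ((a * theta + 2 * b * m ^+ 2) / (2 * b * theta ^+ 2))%:E /\
          'E_P[fun w => (Y w * X w ^+ 2)%R]%E =
            (a / ((b + 2 * theta) * 2 * b ^+ 2 * theta ^+ 2)
             * (theta * (a * b + 2 * a * theta + theta)
                + 2 * m ^+ 2 * b * (2 * theta + b)))%:E]].
Proof.
have mY : measurable_fun setT (Y : T -> R) by exact: measurable_funP.
have mX : measurable_fun setT (X : T -> R) by exact: measurable_funP.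
have [cos_transform sin_transform] : (forall l s : R, 0 <= l ->
    \int[P]_w (cos (s * (X w - m / theta)) * expR (- (l * Y w))) =
    ((eser b theta (s ^+ 2) + l * dser b theta (s ^+ 2) / 2) / b) `^ (- (2 * a))) /\
    (forall l s : R, 0 <= l ->
    \int[P]_w (sin (s * (X w - m / theta)) * expR (- (l * Y w))) = 0).
  suff H (l s : R) : 0 <= l ->
      \int[P]_w (cos (s * (X w - m / theta)) * expR (- (l * Y w))) =
      ((eser b theta (s ^+ 2) + l * dser b theta (s ^+ 2) / 2) / b) `^ (- (2 * a)) /\
      \int[P]_w (sin (s * (X w - m / theta)) * expR (- (l * Y w))) = 0.
    by split => l s /(H l s)[].
  move=> l0; have [hcos hsin] := cexpectation_cexp (YX_transform l s l0).
  rewrite (integral_riccati b_gt0 theta_gt0 (v_sol l s l0)) in hcos hsin.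
  rewrite [m / theta * s]mulrC in hcos hsin.
  have [-> ->] := centered_transform mX mY Y_ge0 l0 hcos hsin; split => //.
  set q := (_ / b); have q0 : 0 < q.
    rewrite divr_gt0// ltr_wpDr//; last exact: eser_gt0 (sqr_ge0 s).
    by rewrite divr_ge0// mulr_ge0// ltW// dser_gt0// sqr_ge0.
  (* The factor 2 in front of the logarithm in [integral_riccati] becomes the exponent
     [- (2 * a)]. *)
  by rewrite /powR gt_eqF//; congr expR; ring.
have lapY := laplace_Y b_gt0 cos_transform.
have a2 : 0 < 2 * a by rewrite mulr_gt0.
have b2 : 0 < 2 * b by rewrite mulr_gt0.
have absj n p := abs_moment_integrable b_gt0 theta_gt0 mY mX Y_ge0 cos_transform n p.
have mom n p : P.-integrable setT (EFin \o (fun w => Y w ^+ n * X w ^+ p)).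
  apply: le_intg (absj n p); first by apply: measurable_funM; apply: measurable_funX.
  by move=> w; rewrite normrM !normrX (ger0_norm (Y_ge0 w)).
have momY n : P.-integrable setT (EFin \o (fun w => Y w ^+ n)).
  by rewrite (_ : (fun w => _) = fun w => Y w ^+ n * X w ^+ 0)//; apply/funext => w; rewrite mulr1.
have momX p : P.-integrable setT (EFin \o (fun w => X w ^+ p)).
  by rewrite (_ : (fun w => _) = fun w => Y w ^+ 0 * X w ^+ p)//; apply/funext => w; rewrite mul1r.
split.
(* Absolute continuity is tested on the measurable subsets [B] of a null set [A]. *)
- move=> A A0 B mB BA.
  apply: (null_dominates_YX a_gt0 b_gt0 theta_gt0 mY mX Y_ge0 cos_transform sin_transform _ mB).
    by move=> C mC; exact: (gamma_law_null mY Y_ge0 a2 b2 lapY mC).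
  exact: A0.
- move=> l l0; rewrite -lapY//; apply: expectation_Rintegral.
  have := intg_expR mY Y_ge0 l0 (momY 0%N).
  by rewrite (_ : EFin \o _ = EFin \o (fun w => expR (- (l * Y w))))//;
    apply/funext => w /=; rewrite mul1r.
- by move=> A mA; exact: (gamma_law mY Y_ge0 a2 b2 lapY mA).
- by move=> n p; rewrite (expectation_Rintegral (absj n p)) ltry.
split.
- by rewrite (expectation_Rintegral (momY 1%N)) (expectation_Y b_gt0 mY Y_ge0 cos_transform).
- by rewrite (expectation_Rintegral (momX 1%N))
    (expectation_X b_gt0 theta_gt0 mY mX Y_ge0 cos_transform sin_transform).
- by rewrite (expectation_Rintegral (momY 2%N)) (expectation_Y2 b_gt0 mY Y_ge0 cos_transform).
- by rewrite (expectation_Rintegral (mom 1%N 1%N))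
    (expectation_YX b_gt0 theta_gt0 mY mX Y_ge0 cos_transform sin_transform).
split.
- by rewrite (expectation_Rintegral (momX 2%N))
    (expectation_X2 b_gt0 theta_gt0 mY mX Y_ge0 cos_transform sin_transform).
- by rewrite (expectation_Rintegral (mom 1%N 2%N))
    (expectation_YX2 b_gt0 theta_gt0 mY mX Y_ge0 cos_transform sin_transform).
Qed.
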